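(* In the notation of the context, for $0\le i,j\le D-1$ and $\mu,\nu\in\{+,-\}$, $$\langle\ell_i^\mu,\ell_j^\nu\rangle_{\mathfrak L}=\delta_{i,j}\delta_{\mu,\nu}\,N_i^\mu,\qquad N_i^-=q^{ie}\prod_{n=1}^i\frac{q^D-q^n}{q^n-1},\quad N_i^+=q^{(i+1)e}\prod_{n=1}^i\frac{q^D-q^n}{q^n-1}.$$
   Context: Let $q$ be a prime power, $D\ge3$ an integer, and $e\in\{0,\tfrac12,1,\tfrac32,2\}$ (with $q$ a square when $e\in\{\tfrac12,\tfrac32\}$); these are the parameters of a dual polar graph of diameter $D$ over $\mathbb F_q$ and $N_i^\pm$ are the sizes of certain vertex sets in it. Let $\tau=\sqrt{-1}\,q^{-(D+e)/2}$. Write $(r;q)_n=(1-r)(1-rq)\cdots(1-rq^{n-1})$ and ${}_3\phi_2\!\left(\begin{smallmatrix}r_1,r_2,r_3\\ s_1,s_2\end{smallmatrix};q,z\right)=\sum_{n\ge0}\frac{(r_1;q)_n(r_2;q)_n(r_3;q)_n}{(s_1;q)_n(s_2;q)_n}\frac{z^n}{(q;q)_n}$. For $t\ne0$ and $0\le i\le d$ let $h_i(\eta;t,d;q)=\frac{(q^{-d};q)_i}{t^i}\,{}_3\phi_2\!\left(\begin{smallmatrix}q^{-i},\,t\eta^{-1},\,t\eta\\ 0,\,q^{-d}\end{smallmatrix};q,q\right)$. Let $h_i=h_i(\eta;\tau,D;q)$, $h_i^\perp=h_i(\eta;\tau q,D-2;q)$ ($0\le i\le D-2$), $h^\perp_{-1}=0$,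 $h^\perp_{D-1}=\eta^{1-D}\prod_{n=1}^{D-1}(\eta-\tau q^n)(\eta-\tau^{-1}q^{-n})$, $p^\perp=\eta^{-1}(\eta-\tau)(\eta-\tau^{-1}q^{-D})$, and for $0\le i\le D-1$: $\ell_i^+=\frac{h_{i+1}-p^\perp h_i^\perp}{\tau^{i+1}(1-q^D)(q;q)_i}$, $\ell_i^-=\frac{q^D-q^i}{\tau^i(q^D-1)(q;q)_i}\big(h_i-\frac{1-q^i}{q^D-q^i}p^\perp h^\perp_{i-1}\big)$. These lie in $\mathfrak L=\operatorname{span}_{\mathbb C}\{\eta^k:-D\le k\le D-1\}$. Let $\lambda_i=\tau q^i$ ($0\le i\le D-1$), $\lambda_{-i}=\tau^{-1}q^{-i}$ ($1\le i\le D$). Let $w_0=1/(-q^e;q)_D$, $w_{-D}=1/(-q^{-e};q)_D$, and for $1\le i\le D-1$: $w_i=(-1)^iq^{i(D+e-i)}\frac{(q^{1-D};q)_i(1+q^D+q^{D+e-i}-q^{D-i})}{(q;q)_i(-q^{e-i};q)_D(1+q^{D+e-2i})}$, $w_{-i}=(-1)^{i-1}q^{i(D+e-i-2)+D+e}\frac{(q^{1-D};q)_{i-1}(1+q^D+q^{i-e}-q^i)}{(q;q)_{i-1}(-q^{e-i+1};q)_D(1+q^{D+e-2i})}$, $c_i=(-1)^iq^{i(D+e-i-1)+D}\frac{(q^{1-D};q)_i}{(q;q)_{i-1}(-q^{e-i+1};q)_{D-1}(1+q^{D+e-2i})}$. Define for $f,g\in\mathfrak L$: $\langle f,g\rangle_{\mathfrak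 L}=\sum_{i=-D}^{D-1}f(\lambda_i)\overline{g(\lambda_i)}\,w_i+\sum_{i=1}^{D-1}\big(f(\lambda_i)\overline{g(\lambda_{-i})}+f(\lambda_{-i})\overline{g(\lambda_i)}\big)c_i$. *)

(* Defs.v *)
(* computations in the algebraic complex numbers algC. *)
From mathcomp Require Import all_boot all_order all_algebra all_field.
Set Implicit Arguments. Unset Strict Implicit. Unset Printing Implicit Defensive.
Import Order.TTheory GRing.Theory Num.Theory.
Local Open Scope ring_scope.

(* The parameter e in {0,1/2,1,3/2,2} is encoded by k : nat, k <= 4, e = k/2. *)

(* q as a complex number *)
Definition qR (q : nat) : algC := q%:R.
(* the positive real fourth root q^(1/4) *)
Definition q4 (q : nat) : algC := sqrtC (sqrtC (qR q)).
(* qpow q a = q^(a/4), a : int *)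
Definition qpow (q : nat) (a : int) : algC := q4 q ^ a.
(* Qp q k a b = q^(a + b*e) with e = k/2 *)
Definition Qp (q k : nat) (a b : int) : algC := qpow q (4 * a + 2 * k%:Z * b).

(* q-Pochhammer symbol (r;q)_n *)
Definition poch (q : nat) (r : algC) (n : nat) : algC :=
  \prod_(m < n) (1 - r * qR q ^+ m).

(* tau = sqrt(-1) * q^(-(D+e)/2) = 'i * q^(-(2D+k)/4) *)
Definition tau (q D k : nat) : algC := 'i * qpow q (- (2 * D%:Z + k%:Z)).

(* h_i(eta; t, d; q); the terminating 3phi2 series (terms with n > i vanish
   since (q^{-i};q)_n = 0 for n > i) *)
Definition hfun (q : nat) (t : algC) (d i : nat) (eta : algC) : algC :=
  poch q (qR q ^- d) i / t ^+ i *
  \sum_(n < i.+1)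
     (poch q (qR q ^- i) n * poch q (t / eta) n * poch q (t * eta) n)
     / (poch q 0 n * poch q (qR q ^- d) n) * qR q ^+ n / poch q (qR q) n.

(* h_i = h_i(eta; tau, D; q) *)
Definition hh (q D k i : nat) (eta : algC) : algC := hfun q (tau q D k) D i eta.

(* h^perp_i for 0 <= i <= D-1 *)
Definition hperp (q D k i : nat) (eta : algC) : algC :=
  let t := tau q D k in
  if i == (D - 1)%N then
    eta ^- (D - 1) *
    \prod_(1 <= n < D) ((eta - t * qR q ^+ n) * (eta - t^-1 * qR q ^- n))
  else hfun q (t * qR q) (D - 2) i eta.

(* h^perp_{i-1} for 0 <= i <= D-1, with h^perp_{-1} = 0 *)
Definition hperp_pred (q D k i : nat) (eta : algC) : algC :=
  if i is i'.+1 then hperp q D k i' eta else 0.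

(* p^perp *)
Definition pperp (q D k : nat) (eta : algC) : algC :=
  let t := tau q D k in eta^-1 * (eta - t) * (eta - t^-1 * qR q ^- D).

Definition ellp (q D k i : nat) (eta : algC) : algC :=
  let t := tau q D k in
  (hh q D k i.+1 eta - pperp q D k eta * hperp q D k i eta)
  / (t ^+ i.+1 * (1 - qR q ^+ D) * poch q (qR q) i).

Definition ellm (q D k i : nat) (eta : algC) : algC :=
  let t := tau q D k in
  (qR q ^+ D - qR q ^+ i) / (t ^+ i * (qR q ^+ D - 1) * poch q (qR q) i) *
  (hh q D k i eta - (1 - qR q ^+ i) / (qR q ^+ D - qR q ^+ i)
                      * pperp q D k eta * hperp_pred q D k i eta).

(* ell mu i : mu = true stands for +, mu = false for - *)
Definition ell (q D k : nat) (mu : bool) (i : nat) : algC -> algC :=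
  if mu then ellp q D k i else ellm q D k i.

(* lambda_i (i >= 0) = tau q^i ; lambda_{-i} (i >= 1) = tau^{-1} q^{-i} *)
Definition lam (q D k : nat) (i : int) : algC :=
  match i with
  | Posz n => tau q D k * qR q ^+ n
  | Negz n => (tau q D k)^-1 * qR q ^- n.+1
  end.

(* weights *)
Definition w0 (q D k : nat) : algC := (poch q (- Qp q k 0 1) D)^-1.
Definition wmD (q D k : nat) : algC := (poch q (- Qp q k 0 (-1)) D)^-1.

(* w_i, 1 <= i <= D-1 *)
Definition wpos (q D k i : nat) : algC :=
  let Q := Qp q k in
  (-1) ^+ i * Q (i%:Z * (D%:Z - i%:Z)) i%:Z   (* q^{i(D+e-i)} *)
  * poch q (qR q ^- (D - 1)) i
  * (1 + qR q ^+ D + Q (D%:Z - i%:Z) 1 - Q (D%:Z - i%:Z) 0)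
  / (poch q (qR q) i * poch q (- Q (- i%:Z) 1) D * (1 + Q (D%:Z - 2 * i%:Z) 1)).

(* w_{-i}, 1 <= i <= D-1 *)
Definition wneg (q D k i : nat) : algC :=
  let Q := Qp q k in
  (-1) ^+ (i - 1) * Q (i%:Z * (D%:Z - i%:Z - 2) + D%:Z) (i%:Z + 1)
      (* q^{i(D+e-i-2)+D+e} *)
  * poch q (qR q ^- (D - 1)) (i - 1)
  * (1 + qR q ^+ D + Q i%:Z (-1) - qR q ^+ i)
  / (poch q (qR q) (i - 1) * poch q (- Q (1 - i%:Z) 1) D
     * (1 + Q (D%:Z - 2 * i%:Z) 1)).

(* c_i, 1 <= i <= D-1 *)
Definition cw (q D k i : nat) : algC :=
  let Q := Qp q k in
  (-1) ^+ i * Q (i%:Z * (D%:Z - i%:Z - 1) + D%:Z) i%:Z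
      (* q^{i(D+e-i-1)+D} *)
  * poch q (qR q ^- (D - 1)) i
  / (poch q (qR q) (i - 1) * poch q (- Q (1 - i%:Z) 1) (D - 1)
     * (1 + Q (D%:Z - 2 * i%:Z) 1)).

(* w_i for -D <= i <= D-1 *)
Definition wt (q D k : nat) (i : int) : algC :=
  match i with
  | Posz 0 => w0 q D k
  | Posz n => wpos q D k n
  | Negz m => if m.+1 == D then wmD q D k else wneg q D k m.+1
  end.

(* the form < f, g >_L, with f, g given by their values *)
Definition formL (q D k : nat) (f g : algC -> algC) : algC :=
  \sum_(n < 2 * D)
     f (lam q D k (n%:Z - D%:Z)) * (g (lam q D k (n%:Z - D%:Z)))^*
       * wt q D k (n%:Z - D%:Z)
  + \sum_(1 <= i < D)
     (f (lam q D k i%:Z) * (g (lam q D k (- i%:Z)))^*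
      + f (lam q D k (- i%:Z)) * (g (lam q D k i%:Z))^*) * cw q D k i.

(* N_i^mu *)
Definition Nval (q D k : nat) (mu : bool) (i : nat) : algC :=
  Qp q k 0 (if mu then i%:Z + 1 else i%:Z)
  * \prod_(1 <= n < i.+1) ((qR q ^+ D - qR q ^+ n) / (qR q ^+ n - 1)).

(* Main.v *)
(** The symmetric functions h_i and the products p^perp h^perp_i are mutually
    orthogonal.  At the nodes lambda_x and lambda_{-x} = 1 / lambda_x a function
    a + p^perp b with a, b symmetric takes the values a + p_x b and a + p_{-x} b;
    the three weights w_x, w_{-x}, c_x are such that the cross terms a b cancel
    in each such pair, that the terms a a carry the dual q-Krawtchouk weight of
    diameter D and parameter tau^2, and that the terms b b carry a multiple of
    the weight of diameter D - 2 and parameter (tau q)^2.  Since h_i and h^perp_i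
    are dual q-Krawtchouk polynomials for these two weights, the claim reduces to
    their orthogonality relations.

    The latter come out of the two second-order equations of the polynomials
    K_n(x).  The three-term recurrence in n gives, through the
    Christoffel-Darboux formula, that the vectors (K_n(x))_n are orthogonal for
    distinct x.  The q-difference equation in x determines the ratios of their
    norms, the norm at x = 0 being a q-binomial sum.  Inverting the matrix
    (K_n(x)) turns this dual relation into the orthogonality relation. *)

Require Import Defs.
From mathcomp Require Import all_boot all_order all_algebra all_field.
From mathcomp Require Import ring zify.
Import GRing.Theory Num.Theory.
Local Open Scope ring_scope.

(** * q-Pochhammer symbols and the finite q-binomial theorem *)

Definition qpoch {F : fieldType} (q r : F) (n : nat) : F :=
  \prod_(m < n) (1 - r * q ^+ m).

Lemma qpoch0 {F : fieldType} (q r : F) : qpoch q r 0 = 1.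
Proof. by rewrite /qpoch big_ord0. Qed.

Lemma qpochS {F : fieldType} (q r : F) n :
  qpoch q r n.+1 = qpoch q r n * (1 - r * q ^+ n).
Proof. by rewrite /qpoch big_ord_recr. Qed.

Lemma qpochSl {F : fieldType} (q r : F) n :
  qpoch q r n.+1 = (1 - r) * qpoch q (r * q) n.
Proof.
rewrite /qpoch big_ord_recl expr0 mulr1; congr (_ * _).
by apply: eq_bigr => m _; rewrite lift0 exprS mulrA.
Qed.

Lemma qpoch_eq0 {F : fieldType} (q : F) n k :
  q != 0 -> (n < k)%N -> qpoch q (q ^- n) k = 0.
Proof.
move=> q0 lt_nk; rewrite /qpoch (bigD1 (Ordinal lt_nk)) //=.
by rewrite mulVf ?expf_neq0 // subrr mul0r.
Qed.

(** Induction on N: a q-Pascal rule splits each term for N + 1 into two terms for N, so that the sum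
    picks up the factor 1 - z q^-(N+1). *)
Lemma sum_qbinomial {F : fieldType} (q z : F) N :
  q != 0 -> (forall n, 1 - q ^+ n.+1 != 0) ->
  \sum_(n < N.+1) qpoch q (q ^- N) n / qpoch q q n * z ^+ n
    = qpoch q (z * q ^- N) N.
Proof.
move=> q0 qn1.
have pq n : qpoch q q n != 0.
  elim: n => [|n IH]; first by rewrite qpoch0 oner_eq0.
  by rewrite qpochS mulf_neq0 // -exprS.
elim: N => [|N IH].
  by rewrite big_ord1 !qpoch0 divr1 mulr1.
have Z0 := expf_neq0 N q0.
have shift (y : F) : y / q ^+ N.+1 * q = y / q ^+ N.
  by rewrite exprS; field; rewrite q0 Z0.
rewrite qpochSl shift -IH exprSr.
have step n : qpoch q ((q ^+ N * q)^-1) n.+1 / qpoch q q n.+1 * z ^+ n.+1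
   = qpoch q (q ^- N) n.+1 / qpoch q q n.+1 * z ^+ n.+1
   - z / (q ^+ N * q) * (qpoch q (q ^- N) n / qpoch q q n * z ^+ n).
  have -> : qpoch q ((q ^+ N * q)^-1) n.+1 =
     (1 - (q ^+ N * q)^-1) * qpoch q (q ^- N) n.
    by rewrite -exprSr qpochSl -[X in qpoch q (X * q)]mul1r shift mul1r.
  have := pq n.+1; rewrite !qpochS !exprS.
  set P := qpoch q q n; set A := qpoch q _ n => h.
  move: Z0; set Z := q ^+ N; set Y := q ^+ n in h *; set W := z ^+ n => Z0.
  move: h; rewrite mulf_eq0 negb_or => /andP[h1 h2].
  by field; rewrite q0 Z0 h1 h2.
rewrite big_ord_recl /=.
under eq_bigr => n _ do rewrite step.
rewrite sumrB big_ord_recr /= (qpoch_eq0 _ _ _ q0 (ltnSn N)) !mul0r addr0.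
rewrite mulrBl mul1r mulr_sumr [in RHS]big_ord_recl !qpoch0 addrA.
by [].
Qed.

(** The factors are read backwards, and 1 - 1/(r p^i) = (1 - r p^i) / (-r p^i). *)
Lemma qpoch_reverse {F : fieldType} (p r : F) n : p != 0 -> r != 0 ->
  qpoch p (r^-1 / p ^+ n) n.+1
  = qpoch p r n.+1 / ((- r) ^+ n.+1 * \prod_(i < n.+1) p ^+ i).
Proof.
move=> p0 r0; have -> : (- r) ^+ n.+1 = \prod_(i < n.+1) (- r).
  by rewrite prodr_const card_ord.
rewrite -big_split -prodfV -big_split /qpoch (reindex_inj rev_ord_inj) /=.
apply: eq_bigr => i _; have le_in : (i <= n)%N by rewrite -ltnS.
rewrite subSS -[X in _ / p ^+ X * _](subnK le_in) exprD.
by field; rewrite oppr_eq0 r0 !expf_neq0.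
Qed.

(** * Dual q-Krawtchouk polynomials *)

Section DualKrawtchouk.

Context {F : fieldType} (q s : F) (N : nat).
Context (q0 : q != 0) (qn1 : forall n, 1 - q ^+ n.+1 != 0).
Context (s0 : s != 0) (qs : forall a b, q ^+ a - s * q ^+ b != 0).

Definition dqk_coef (n k : nat) : F :=
  qpoch q (q ^- n) k * q ^+ k / (qpoch q (q ^- N) k * qpoch q q k).

Definition dqk_base (k : nat) (X : F) : F := qpoch q X^-1 k * qpoch q (s * X) k.

(* With s = c q^-N this is K_n(q^-x + s q^x; c, N | q) in the Askey scheme,
   meaningful for n <= N: for k <= N the denominators of [dqk_coef n k] are
   nonzero. *)
Definition dqk (n x : nat) : F :=
  \sum_(k < N.+1) dqk_coef n k * dqk_base k (q ^+ x).

(** [dqk_up] and [dqk_down] are the coefficients of the q-difference equation in x. The first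
    vanishes at X = q^N and the second at X = 1, which closes the equation on 0, ..., N. *)
Definition dqk_up (X : F) : F :=
  (1 - X / q ^+ N) * (1 - s * X) / ((1 - s * X ^+ 2) * (1 - s * X ^+ 2 * q)).

Definition dqk_down (X : F) : F :=
  s * X ^+ 2 * (1 - X) * (1 - s * q ^+ N * X)
  / (q ^+ N * (q - s * X ^+ 2) * (1 - s * X ^+ 2)).

(** The consecutive ratios make the three-term recurrence in n symmetric; the reciprocals turn out
    to be the squared norms of the K_n. *)
Definition dqk_dualwt (n : nat) : F :=
  qpoch q (q ^- N) n / qpoch q q n * s^-1 ^+ n.

(** The ratios are those for which the q-difference operator is symmetric; the value at x = 0 is the
    reciprocal of a q-binomial sum. *)
Definition dqk_wt (x : nat) : F :=
  (qpoch q (s^-1 * q ^- N) N)^-1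
  * \prod_(j < x) (dqk_up (q ^+ j) / dqk_down (q ^+ j.+1)).

Lemma qX0 n : q ^+ n != 0. Proof. exact: expf_neq0. Qed.

Lemma invqSK n : q ^- n.+1 * q = q ^- n.
Proof. by rewrite exprS invfM mulrAC mulVf // mul1r. Qed.

Lemma qpochq_neq0 n : qpoch q q n != 0.
Proof.
elim: n => [|n IH]; first by rewrite qpoch0 oner_eq0.
by rewrite qpochS mulf_neq0 // -exprS.
Qed.

Lemma subqX_neq0 m n : m != n -> q ^+ m - q ^+ n != 0.
Proof.
wlog lt_mn: m n / (m < n)%N => [hw|].
  rewrite neq_ltn => /orP[h|h]; first by apply: hw => //; rewrite ltn_eqF.
  by rewrite -opprB oppr_eq0; apply: hw => //; rewrite ltn_eqF.
move=> _; have -> : q ^+ n = q ^+ (n - m.+1).+1 * q ^+ m.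
  by rewrite -exprD addSnnS subnK.
by rewrite -[X in X - _]mul1r -mulrBl mulf_neq0 ?qX0.
Qed.

Lemma qpochqN_neq0 k : (k <= N)%N -> qpoch q (q ^- N) k != 0.
Proof.
move=> le_kN; rewrite /qpoch; apply/prodf_neq0 => i _.
have ne : (i : nat) != N by rewrite neq_ltn (leq_trans (ltn_ord i) le_kN).
apply: contra (subqX_neq0 _ _ ne) => /eqP e; apply/eqP.
have -> : q ^+ i - q ^+ N = - q ^+ N * (1 - q ^- N * q ^+ i) by field; exact: qX0.
by rewrite e mulr0.
Qed.

(* The values [dqk 0.-1 x] at n = 0 and [dqk N.+1 x] at n = N are junk, but have
   coefficient zero.  Expanded in [dqk_base k], the identity telescopes in k, and
   the boundary term vanishes since [dqk_base N.+1] has a zero at q^x. *)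
Lemma dqk_recurrence n x : (n <= N)%N -> (x <= N)%N ->
  (1 - q ^- x) * (1 - s * q ^+ x) * dqk n x
  = s * (1 - q ^+ n) * (dqk n x - dqk n.-1 x)
    - (1 - q ^+ n / q ^+ N) * (dqk n.+1 x - dqk n x).
Proof.
move=> le_nN le_xN; apply/eqP; rewrite -subr_eq0; apply/eqP.
set E := _ * (1 - _).
pose term k := (E * dqk_coef n k - s * (1 - q ^+ n) * (dqk_coef n k - dqk_coef n.-1 k)
    + (1 - q ^+ n / q ^+ N) * (dqk_coef n.+1 k - dqk_coef n k)) * dqk_base k (q ^+ x).
transitivity (\sum_(k < N.+1) term k).
  rewrite /dqk -!sumrB !mulr_sumr -sumrB -sumrB; apply: eq_bigr => k _.
  by rewrite /term; ring.
have tele k : (k <= N)%N -> \sum_(j < k.+1) term j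
    = dqk_coef n k / q ^+ k * dqk_base k.+1 (q ^+ x).
  elim: k => [_|k IH lt_kN].
    rewrite big_ord1 /term /dqk_coef /dqk_base !qpochS !qpoch0 !expr0 /E.
    by field; rewrite !qX0 oner_eq0.
  rewrite big_ord_recr IH ?(ltnW lt_kN) //= /term.
  have e1 : dqk_coef n.+1 k.+1 - dqk_coef n k.+1 =
     - (1 - q ^+ k.+1) / q ^+ n.+1 * qpoch q (q ^- n) k * q ^+ k.+1
       / (qpoch q (q ^- N) k.+1 * qpoch q q k.+1).
    rewrite /dqk_coef -mulrBl -mulrBl; congr (_ * _ * _).
    rewrite (qpochSl q (q ^- n.+1)) invqSK qpochS !exprS.
    have := qX0 n; move: (q ^+ n) (q ^+ k) => Y W Y0.
    by field; rewrite q0 Y0.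
  have e2 : (1 - q ^+ n) * (dqk_coef n k.+1 - dqk_coef n.-1 k.+1) =
     (1 - q ^+ k.+1) * qpoch q (q ^- n) k.+1 * q ^+ k.+1
       / (qpoch q (q ^- N) k.+1 * qpoch q q k.+1).
    rewrite /dqk_coef -mulrBl -mulrBl !mulrA; congr (_ * _ * _).
    (* At n = 0 the index [n.-1] is not a predecessor, but both sides are zero: the left one through
       1 - q^0, the right one through the first factor of (1;q)_(k+1). *)
    case: n {E le_nN term IH e1} => [|n] /=.
      by rewrite expr0 subrr mul0r qpochSl invr1 subrr mul0r mulr0.
    rewrite (qpochSl q (q ^- n.+1)) invqSK qpochS.
    rewrite !exprS; have := qX0 n; move: (q ^+ n) (q ^+ k) => Y W Y0.
    by field; rewrite q0 Y0.
  rewrite -[s * _ * _]mulrA e1 e2 /dqk_coef /dqk_base /E !qpochS !exprS.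
  have := qX0 n; have := qX0 k; have := qX0 x; have := qX0 N.
  have := qpochqN_neq0 _ lt_kN; rewrite qpochS mulf_eq0 negb_or => /andP[].
  have := qpochq_neq0 k.+1; rewrite qpochS mulf_eq0 negb_or => /andP[].
  have -> z : 1 - (q ^+ N)^-1 * z = (q ^+ N - z) / q ^+ N by field; exact: qX0.
  move: (q ^+ n) (q ^+ k) (q ^+ x) (q ^+ N) (qpoch q q k) (qpoch q _ k) => Y W X Z P1 P2.
  move: (qpoch q _ k) (qpoch q _ k) (qpoch q _ k) => P3 P4 P5.
  move=> h1 h2 h3 h4 Z0 X0 W0 Y0.
  move: h4; rewrite mulf_eq0 negb_or invr_eq0 => /andP[h4 _].
  by field; rewrite q0 h1 h2 h3 h4 Z0 X0 W0 Y0.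
rewrite tele // /dqk_base (qpoch_eq0 _ _ _ q0) ?ltnS //.
by rewrite mul0r mulr0.
Qed.

(** * Dual orthogonality by the Christoffel-Darboux formula *)

Lemma dqk_dualwtS n :
  dqk_dualwt n.+1 * (s * (1 - q ^+ n.+1))
  = dqk_dualwt n * (1 - q ^+ n / q ^+ N).
Proof.
rewrite /dqk_dualwt !qpochS -exprS [s^-1 ^+ n.+1]exprS.
have := qn1 n; have := qpochq_neq0 n; have := qX0 N.
move: (q ^+ n.+1) (q ^+ n) (q ^+ N) (qpoch q q n) => Y1 Y Z P Z0 P0 Y10.
by field; rewrite s0 Z0 P0 Y10.
Qed.

(** The recurrence at x times K_m(y), minus the recurrence at y times K_m(x), telescopes in m once
    weighted, by [dqk_dualwtS]. *)
Lemma dqk_christoffel_darboux n x y : (n <= N)%N -> (x <= N)%N -> (y <= N)%N ->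
  ((1 - q ^- x) * (1 - s * q ^+ x) - (1 - q ^- y) * (1 - s * q ^+ y))
  * \sum_(m < n.+1) dqk_dualwt m * dqk m x * dqk m y
  = dqk_dualwt n * (1 - q ^+ n / q ^+ N)
    * (dqk n x * dqk n.+1 y - dqk n.+1 x * dqk n y).
Proof.
move=> + le_xN le_yN; set Ex := (1 - q ^- x) * _; set Ey := (1 - q ^- y) * _.
elim: n => [|n IH] le_nN.
  have ex := dqk_recurrence 0 x le_nN le_xN.
  have ey := dqk_recurrence 0 y le_nN le_yN.
  move: ex ey; rewrite -/Ex -/Ey /= !subrr !mulr0 !sub0r big_ord1 => ex ey.
  rewrite -mulrA mulrCA -[RHS]mulrA; congr (_ * _).
  rewrite mulrBl mulrA ex [Ey * _]mulrCA ey; ring.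
have ex := dqk_recurrence n.+1 x le_nN le_xN.
have ey := dqk_recurrence n.+1 y le_nN le_yN.
rewrite -/Ex -/Ey /= in ex ey.
rewrite big_ord_recr /= mulrDr IH ?(ltnW le_nN) // -dqk_dualwtS.
have -> : (Ex - Ey) * (dqk_dualwt n.+1 * dqk n.+1 x * dqk n.+1 y)
  = dqk_dualwt n.+1 * ((Ex * dqk n.+1 x) * dqk n.+1 y
                       - dqk n.+1 x * (Ey * dqk n.+1 y)) by ring.
rewrite ex ey; ring.
Qed.

(** At n = N the boundary coefficient 1 - q^n / q^N of the Christoffel-Darboux formula is zero,
    while the eigenvalues at x and y differ because [qs] excludes s q^(x+y) = 1. *)
Lemma dqk_dual_orthogonal x y : (x <= N)%N -> (y <= N)%N -> x != y ->
  \sum_(n < N.+1) dqk_dualwt n * dqk n x * dqk n y = 0.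
Proof.
move=> le_xN le_yN ne_xy; apply/eqP.
have := dqk_christoffel_darboux N x y (leqnn N) le_xN le_yN.
rewrite divff ?qX0 // subrr mulr0 mul0r => /eqP; rewrite mulf_eq0 => /orP[|//].
have -> : (1 - q ^- x) * (1 - s * q ^+ x) - (1 - q ^- y) * (1 - s * q ^+ y)
  = (q ^+ x - q ^+ y) * (q ^+ 0 - s * q ^+ (x + y)) / (q ^+ x * q ^+ y).
  by rewrite expr0 exprD; field; rewrite !qX0.
by rewrite !mulf_eq0 invr_eq0 mulf_eq0 !(negPf (qX0 _)) (negPf (qs _ _))
           (negPf (subqX_neq0 _ _ ne_xy)).
Qed.

(** * The q-difference equation in x and the norms in the dual relation *)

Lemma dqk_base_difference k X : X != 0 ->
  1 - s * X != 0 -> q - s * X ^+ 2 != 0 ->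
  1 - s * X ^+ 2 != 0 -> 1 - s * X ^+ 2 * q != 0 ->
  dqk_up X * (dqk_base k.+1 (q * X) - dqk_base k.+1 X)
  - dqk_down X * (dqk_base k.+1 X - dqk_base k.+1 (X / q))
  = (q ^- k.+1 - 1) * dqk_base k.+1 X
    - q ^- k.+1 * (1 - q ^+ k / q ^+ N) * (1 - q ^+ k.+1) * dqk_base k X.
Proof.
move=> X0 h1 h2 h3 h4; rewrite /dqk_base.
have eP : (1 - X) * qpoch q (X^-1 * q) k = - X * qpoch q X^-1 k * (1 - X^-1 * q ^+ k).
  rewrite -mulrA -qpochS qpochSl; field; exact: X0.
have eR : qpoch q (s * X * q) k = qpoch q (s * X) k * (1 - s * X * q ^+ k) / (1 - s * X).
  by rewrite -qpochS qpochSl; field; exact: h1.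
have E1 : (q * X)^-1 * q = X^-1 by field; rewrite q0 X0.
have E2 : s * (X / q) * q = s * X by field.
have E3 : s * (q * X) = s * X * q by ring.
have E4 : (X / q)^-1 = X^-1 * q by field; rewrite q0 X0.
rewrite [qpoch q (q * X)^-1 k.+1]qpochSl E1 E3 E4.
rewrite [qpoch q (s * (X / q)) k.+1]qpochSl E2 !qpochS eR.
move: eP; rewrite /dqk_up /dqk_down (exprS q k); have := qX0 N; have := qX0 k.
move: (q ^+ k) (q ^+ N) (qpoch q X^-1 k) (qpoch q (s * X) k) => W Z P R.
move: (qpoch q _ k) => P' W0 Z0 eP.
set d := s * X ^+ 2 * (1 - X) * _ / _.
have -> : d * (P * (1 - X^-1 * W) * (R * (1 - s * X * W)) -
      P' * (1 - X^-1 * q * W) * ((1 - s * (X / q)) * R))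
  = s * X ^+ 2 * (1 - s * Z * X) / (Z * (q - s * X ^+ 2) * (1 - s * X ^+ 2))
   * ((1 - X) * (P * (1 - X^-1 * W) * (R * (1 - s * X * W))) -
     ((1 - X) * P') * (1 - X^-1 * q * W) * ((1 - s * (X / q)) * R)).
  by rewrite /d; field; rewrite X0 q0 Z0 h2 h3.
rewrite eP; field.
by rewrite q0 X0 Z0 W0 h1 h2 h3 h4.
Qed.

Lemma subsqX_neq0 x :
  [/\ 1 - s * q ^+ x != 0, q - s * (q ^+ x) ^+ 2 != 0,
      1 - s * (q ^+ x) ^+ 2 != 0 & 1 - s * (q ^+ x) ^+ 2 * q != 0].
Proof.
rewrite -exprM -[_ * q]mulrA -exprSr.
by split; [exact: (qs 0) | exact: (qs 1) | exact: (qs 0) | exact: (qs 0)].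
Qed.

(** By [dqk_base_difference] the operator sends each basis product to a combination of itself and
    the preceding one, so the expansion of K_n telescopes in k. *)
Lemma dqk_difference n x : (n <= N)%N ->
  (q ^- n - 1) * dqk n x
  = dqk_up (q ^+ x) * (dqk n x.+1 - dqk n x)
    - dqk_down (q ^+ x) * (dqk n x - dqk n x.-1).
Proof.
move=> le_nN; set X := q ^+ x.
(* At x = 0 the argument X / q is not the power belonging to [x.-1], but there [dqk_down]
   vanishes. *)
have -> : dqk_down X * (dqk n x - dqk n x.-1)
  = dqk_down X * (dqk n x - \sum_(k < N.+1) dqk_coef n k * dqk_base k (X / q)).
  rewrite /X; case: x {X} => [|x]; last by rewrite exprSr mulfK.
  by rewrite /dqk_down expr0 subrr mulr0 !mul0r.
apply/eqP; rewrite -subr_eq0; apply/eqP.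
pose term k := dqk_coef n k * ((q ^- n - 1) * dqk_base k X
   - (dqk_up X * (dqk_base k (q * X) - dqk_base k X)
      - dqk_down X * (dqk_base k X - dqk_base k (X / q)))).
transitivity (\sum_(k < N.+1) term k).
  rewrite /dqk exprS -/X -!sumrB !mulr_sumr -!sumrB; apply: eq_bigr => k _.
  by rewrite /term; ring.
have tele k : (k <= N)%N -> \sum_(j < k.+1) term j
    = dqk_coef n k * (q ^- n - q ^- k) * dqk_base k X.
  elim: k => [_|k IH lt_kN].
    rewrite big_ord1 /term /dqk_base !qpoch0 expr0 invr1; ring.
  rewrite big_ord_recr IH ?(ltnW lt_kN) //= /term.
  case: (subsqX_neq0 x) => h1 h2 h3 h4.
  rewrite dqk_base_difference ?qX0 //.
  rewrite /dqk_coef !qpochS !exprS.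
  have := qX0 n; have := qX0 k; have := qX0 N.
  have := qpochqN_neq0 _ lt_kN; rewrite qpochS mulf_eq0 negb_or => /andP[].
  have := qpochq_neq0 k.+1; rewrite qpochS mulf_eq0 negb_or => /andP[].
  have -> z : 1 - (q ^+ N)^-1 * z = (q ^+ N - z) / q ^+ N by field; exact: qX0.
  move: (q ^+ n) (q ^+ k) (q ^+ N) (qpoch q q k) (qpoch q _ k) => Y W Z P1 P2.
  move: (qpoch q _ k) (dqk_base _ _) (dqk_base _ _) => P3 P4 P5.
  move=> g1 g2 g3 + Z0 W0 Y0.
  rewrite mulf_eq0 negb_or invr_eq0 => /andP[g4 _].
  by field; rewrite q0 g1 g2 g3 g4 Z0 W0 Y0.
(* The boundary term vanishes through q^-n - q^-N if n = N, and through (q^-n;q)_N if n < N. *)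
rewrite tele //; move: le_nN; rewrite leq_eqVlt => /orP[/eqP->|lt_nN].
  by rewrite subrr mulr0 mul0r.
by rewrite /dqk_coef (qpoch_eq0 _ _ _ q0 lt_nN) !mul0r.
Qed.

Definition dqk_dualnorm (x : nat) : F :=
  \sum_(n < N.+1) dqk_dualwt n * dqk n x ^+ 2.

Lemma dqk_down_neq0 x : (x < N)%N -> dqk_down (q ^+ x.+1) != 0.
Proof.
move=> lt_xN; case: (subsqX_neq0 x.+1) => _ h2 h3 _.
rewrite /dqk_down mulf_neq0 ?invr_eq0 ?mulf_neq0 ?expf_neq0 ?qX0 //.
by rewrite -mulrA -exprD (qs 0).
Qed.

Lemma dqk_up_neq0 x : (x < N)%N -> dqk_up (q ^+ x) != 0.
Proof.
move=> lt_xN; case: (subsqX_neq0 x) => h1 _ h3 h4.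
rewrite /dqk_up mulf_neq0 ?invr_eq0 ?mulf_neq0 //.
have -> : 1 - q ^+ x / q ^+ N = (q ^+ N - q ^+ x) / q ^+ N by field; exact: qX0.
by rewrite mulf_neq0 ?invr_eq0 ?qX0 ?subqX_neq0 // gtn_eqF.
Qed.

(** The weighted sum of (q^-n - 1) K_n(x) K_n(x+1) is computed twice, with the q-difference equation
    applied at x and then at x + 1. Dual orthogonality leaves a single norm in each result. *)
Lemma dqk_dualnormS x : (x < N)%N ->
  dqk_up (q ^+ x) * dqk_dualnorm x.+1 = dqk_down (q ^+ x.+1) * dqk_dualnorm x.
Proof.
move=> lt_xN; have le_xN := ltnW lt_xN.
have orth y z : (y <= N)%N -> (z <= N)%N -> y != z -> forall c,
    \sum_(n < N.+1) c * (dqk_dualwt n * dqk n y * dqk n z) = 0.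
  by move=> *; rewrite -mulr_sumr dqk_dual_orthogonal ?mulr0.
transitivity (\sum_(n < N.+1) dqk_dualwt n * ((q ^- n - 1) * dqk n x) * dqk n x.+1).
  under [RHS]eq_bigr => n _ do rewrite (dqk_difference _ _ (ltn_ord n : n <= N)%N).
  transitivity (\sum_(n < N.+1) (dqk_up (q ^+ x) * (dqk_dualwt n * dqk n x.+1 ^+ 2)
     + (- (dqk_up (q ^+ x) + dqk_down (q ^+ x))) * (dqk_dualwt n * dqk n x * dqk n x.+1)
     + dqk_down (q ^+ x) * (dqk_dualwt n * dqk n x.-1 * dqk n x.+1))).
    rewrite !big_split /= -mulr_sumr orth ?ltn_eqF // addr0.
    case: x lt_xN {le_xN} => [|x] lt_xN.
      rewrite [X in _ + X]big1 ?addr0 // => n _.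
      by rewrite /dqk_down expr0 subrr mulr0 !mul0r.
    by rewrite orth ?addr0 //=; lia.
  by apply: eq_bigr => n _; ring.
transitivity (\sum_(n < N.+1) dqk_dualwt n * ((q ^- n - 1) * dqk n x.+1) * dqk n x).
  by apply: eq_bigr => n _; ring.
under eq_bigr => n _ do rewrite (dqk_difference _ _ (ltn_ord n : n <= N)%N).
transitivity (\sum_(n < N.+1) (dqk_down (q ^+ x.+1) * (dqk_dualwt n * dqk n x ^+ 2)
     + (- (dqk_up (q ^+ x.+1) + dqk_down (q ^+ x.+1))) * (dqk_dualwt n * dqk n x.+1 * dqk n x)
     + dqk_up (q ^+ x.+1) * (dqk_dualwt n * dqk n x.+2 * dqk n x))).
  by apply: eq_bigr => n _ /=; ring.
rewrite !big_split /= -mulr_sumr orth ?gtn_eqF // addr0.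
(* If x + 1 = N, the point x + 2 is outside the range of dual orthogonality, but its coefficient
   [dqk_up] vanishes at q^N. *)
move: lt_xN; rewrite leq_eqVlt => /orP[/eqP eN|lt_xN]; last first.
  by rewrite orth ?addr0 //; lia.
rewrite [X in _ + X]big1 ?addr0 // => n _.
by rewrite /dqk_up eN divff ?qX0 // subrr !mul0r.
Qed.

Lemma dqk_x0 n : dqk n 0 = 1.
Proof.
rewrite /dqk big_ord_recl big1 ?addr0 => [|k _].
  by rewrite /dqk_coef /dqk_base !qpoch0 expr0 !mulr1 divr1.
by rewrite /dqk_base lift0 expr0 qpochSl invr1 subrr !mul0r mulr0.
Qed.

Lemma dqk_dualnorm_wt x : (x <= N)%N -> dqk_dualnorm x * dqk_wt x = 1.
Proof.
elim: x => [_|x IH lt_xN].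
  rewrite /dqk_wt big_ord0 mulr1 /dqk_dualnorm.
  under eq_bigr => n _ do rewrite dqk_x0 expr1n mulr1.
  rewrite sum_qbinomial // mulfV // /qpoch; apply/prodf_neq0 => i _.
  have -> : 1 - s^-1 / q ^+ N * q ^+ i = - (q ^+ i - s * q ^+ N) / (s * q ^+ N).
    by field; rewrite s0 qX0.
  by rewrite mulf_neq0 ?oppr_eq0 ?qs // invr_eq0 mulf_neq0 ?qX0.
rewrite -[RHS](IH (ltnW lt_xN)) /dqk_wt big_ord_recr /=.
have h := dqk_dualnormS x lt_xN; have hd := dqk_down_neq0 x lt_xN.
have hu := dqk_up_neq0 x lt_xN.
have -> : dqk_dualnorm x.+1 = dqk_down (q ^+ x.+1) * dqk_dualnorm x / dqk_up (q ^+ x).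
  by rewrite -h mulrAC mulfV // mul1r.
set A := (qpoch _ _ _)^-1; set B := \prod_(_ < _) _.
by field; rewrite hd hu.
Qed.

Lemma dqk_wtS x : (x < N)%N ->
  dqk_wt x.+1 * dqk_down (q ^+ x.+1) = dqk_wt x * dqk_up (q ^+ x).
Proof.
move=> lt_xN; rewrite /dqk_wt big_ord_recr /=.
by rewrite -mulrA -[X in _ * X]mulrA mulfVK ?mulrA // dqk_down_neq0.
Qed.

(* The dual orthogonality reads K^T V K = M for diagonal V, M, so that
   M^-1 K^T V is a left, hence also a right, inverse of K. *)
Lemma dqk_orthogonal m n : (m <= N)%N -> (n <= N)%N ->
  \sum_(x < N.+1) dqk m x * dqk n x * dqk_wt x = (m == n)%:R / dqk_dualwt n.
Proof.
move=> le_mN le_nN.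
pose K := \matrix_(a < N.+1, x < N.+1) dqk a x.
pose L := \matrix_(x < N.+1, a < N.+1) (dqk_wt x * dqk a x * dqk_dualwt a).
have LK : L *m K = 1%:M.
  apply/matrixP => x y; rewrite !mxE.
  transitivity (dqk_wt x * \sum_(a < N.+1) dqk_dualwt a * dqk a x * dqk a y).
    by rewrite mulr_sumr; apply: eq_bigr => a _; rewrite !mxE; ring.
  have [->|ne] := eqVneq x y.
    rewrite -(dqk_dualnorm_wt y) -1?ltnS // mulrC; congr (_ * _).
    by apply: eq_bigr => a _; ring.
  by rewrite dqk_dual_orthogonal ?mulr0 // -ltnS.
have v0 : dqk_dualwt n != 0.
  by rewrite /dqk_dualwt !mulf_neq0 ?invr_eq0 ?qpochq_neq0 ?qpochqN_neq0
             ?expf_neq0 ?invr_eq0.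
have /matrixP/(_ (Ordinal (le_mN : (m < N.+1)%N)) (Ordinal (le_nN : (n < N.+1)%N))) :=
  mulmx1C LK.
rewrite !mxE => e; apply: (mulIf v0); rewrite mulfVK // mulr_suml.
transitivity (\sum_(x < N.+1) dqk m x * (dqk_wt x * dqk n x * dqk_dualwt n)).
  by apply: eq_bigr => x _; ring.
by move: e; under eq_bigr => x _ do rewrite !mxE /=.
Qed.

End DualKrawtchouk.

(** * Ratios of the weights *)

(* With E = q^e, Z = q^D and X = q^x, [wpos_ratio], [wneg_ratio] and [cw_step] are
   w_x / c_x, w_{-x} / c_x and c_{x+1} / c_x, while [ppos] and [pneg] are the
   values of p^perp / tau at lambda_x and lambda_{-x}. *)
Section WeightRatios.

Context {F : fieldType} (q E Z : F).

Definition wpos_ratio (X : F) : F :=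
  X * (1 + Z + E * Z / X - Z / X) / (Z * (1 - X) * (1 + E / X)).
Definition wneg_ratio (X : F) : F :=
  - (E * Z / X * (1 + Z + X / E - X) / ((Z - X) * (1 + E * Z / X))).
Definition cw_step (X : F) : F :=
  - (E / (X ^+ 2 * q ^+ 2) * (Z - q * X) * (1 + E * Z / (q * X))
     * (1 + E * Z / X ^+ 2)
     / ((1 - X) * (1 + E / X) * (1 + E * Z / (X ^+ 2 * q ^+ 2)))).
Definition ppos (X : F) : F := (X - 1) * (1 + E / X).
Definition pneg (X : F) : F := - ((1 + E * Z / X) * (1 - X / Z)).
(** Divided by c_x, the form on a pair of nodes has the matrix with diagonal w_x / c_x, w_{-x} / c_x
    and off-diagonal entries 1. [sym_ratio] is its value on the vector (1, 1), [perp_ratio] its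
    value on ([ppos], [pneg]). *)
Definition sym_ratio (X : F) : F := wpos_ratio X + wneg_ratio X + 2 * 1.
Definition perp_ratio (X : F) : F :=
  wpos_ratio X * ppos X ^+ 2 + wneg_ratio X * pneg X ^+ 2 + 2 * (ppos X * pneg X).

Context (D : nat).
Context (q0 : q != 0) (qn1 : forall n, 1 - q ^+ n.+1 != 0).
Context (E0 : E != 0) (qE : forall a b, q ^+ a + E * q ^+ b != 0).
Context (eZ : q ^+ D = Z).

(** This is tau^2 in terms of E = q^e and Z = q^D. *)
Let s := - (Z * E)^-1.

Let Z0 : Z != 0. Proof. by rewrite -eZ expf_neq0. Qed.

Lemma ratio_params_neq0 a b : q ^+ a - s * q ^+ b != 0.
Proof.
have -> : q ^+ a - s * q ^+ b = (q ^+ b + E * q ^+ (a + D)) / (Z * E).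
  by rewrite /s exprD eZ; field; rewrite E0 Z0.
by rewrite mulf_neq0 ?invr_eq0 ?mulf_neq0.
Qed.

Lemma ratio_conditions x : (0 < x < D)%N -> let X := q ^+ x in
  [/\ X != 0, 1 - X != 0, Z - X != 0, X + E != 0 & X + E * Z != 0] /\
  [/\ Z * E - -1 * (X ^+ 2) != 0, Z * E - -1 * (X ^+ 2) * q != 0
    & q * (Z * E) - -1 * (X ^+ 2) != 0].
Proof.
move=> /andP[x_gt0 lt_xD] X.
split; split.
- exact: expf_neq0.
- by rewrite -[1](expr0 q) subqX_neq0 // eq_sym lt0n_neq0.
- by rewrite -eZ subqX_neq0 // gtn_eqF.
- by rewrite -[E]mulr1 -[1](expr0 q) qE.
- by rewrite -eZ qE.
- by have := qE (x * 2) D; rewrite exprM eZ; congr (_ != 0); rewrite /X; ring.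
- by have := qE (x * 2).+1 D; rewrite exprS exprM eZ; congr (_ != 0); rewrite /X; ring.
- by have := qE (x * 2) D.+1; rewrite exprS exprM eZ; congr (_ != 0); rewrite /X; ring.
Qed.

(** The vectors (1, 1) and ([ppos], [pneg]) are orthogonal for the form on each pair of nodes; this
    removes the mixed terms between symmetric functions and multiples of p^perp. *)
Lemma cross_ratio x : (0 < x < D)%N -> let X := q ^+ x in
  wpos_ratio X * ppos X + wneg_ratio X * pneg X + (ppos X + pneg X) = 0.
Proof.
move=> hx; case: (ratio_conditions x hx); set X := q ^+ x.
case=> X0 h1 h2 h3 h4 _; rewrite /wpos_ratio /wneg_ratio /ppos /pneg.
by field; rewrite X0 E0 Z0 h1 h2 h3 h4.
Qed.

(** Gives c_x times [sym_ratio] the first-order recurrence [dqk_wtS] of the weight of diameter D. *)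
Lemma sym_ratio_step x : (0 < x)%N -> (x.+1 < D)%N -> let X := q ^+ x in
  cw_step X * sym_ratio (q * X) * dqk_down q s D (q * X)
  = sym_ratio X * dqk_up q s D X.
Proof.
move=> x_gt0 lt_xD.
case: (ratio_conditions x); first by rewrite x_gt0 ltnW.
case: (ratio_conditions x.+1) => //; rewrite exprS.
set X := q ^+ x => -[_ g1 g2 g3 g4] [g5 g6 g7] [X0 h1 h2 h3 h4] [h5 h6 h7].
rewrite /sym_ratio /wpos_ratio /wneg_ratio /cw_step /dqk_down /dqk_up eZ /s.
field.
by rewrite X0 q0 E0 Z0 h1 h2 h3 h4 h5 h6 g1 g2 g3 g4 g5 g7.
Qed.

(** The analogue for diameter D - 2 and parameter (tau q)^2. The pair of nodes x plays the part of
    the point x - 1, whence the arguments X and X / q in place of q X and X. *)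
Lemma perp_ratio_step x : (0 < x)%N -> (x.+1 < D)%N -> let X := q ^+ x in
  cw_step X * perp_ratio (q * X) * dqk_down q (s * q ^+ 2) (D - 2) X
  = perp_ratio X * dqk_up q (s * q ^+ 2) (D - 2) (X / q).
Proof.
move=> x_gt0 lt_xD.
case: (ratio_conditions x); first by rewrite x_gt0 ltnW.
case: (ratio_conditions x.+1) => //; rewrite exprS.
set X := q ^+ x => -[_ g1 g2 g3 g4] [g5 g6 g7] [X0 h1 h2 h3 h4] [h5 h6 h7].
have eZ2 : q ^+ (D - 2) = Z / q ^+ 2.
  rewrite -eZ -[in RHS](subnK (_ : 2 <= D)%N) ?exprD ?mulfK ?expf_neq0 //.
  by apply: leq_trans lt_xD.
rewrite /perp_ratio /ppos /pneg /wpos_ratio /wneg_ratio /cw_step /dqk_down /dqk_up eZ2 /s.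
rewrite !exprMn !(mulrA (-1) (q ^+ 2)) in g5 g7.
field.
by rewrite X0 q0 E0 Z0 h1 h2 h3 h4 h5 h6 g1 g2 g3 g4 g5 g7.
Qed.

(** The passage from x = 0 to x = 1: the prefactor is c_1 (-E;q)_(D-1), and 1 + E Z / q is the last
    factor of 1 / w_0. *)
Lemma sym_ratio_first : (1 < D)%N ->
  - (q ^- 2 * Z ^+ 2 * E * (1 - q / Z) / (1 + E * Z / q ^+ 2)) * sym_ratio q
  * dqk_down q s D q = dqk_up q s D 1 / (1 + E * Z / q).
Proof.
move=> D_gt1; case: (ratio_conditions 1) => //; rewrite expr1.
case=> _ h1 h2 h3 h4 [h5 h6 h7].
rewrite /sym_ratio /wpos_ratio /wneg_ratio /cw_step /dqk_down /dqk_up eZ /s.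
have g1 : Z * E + 1 != 0 by rewrite addrC mulrC -eZ -[1](expr0 q).
by field; rewrite q0 E0 Z0 g1 h1 h2 h3 h4 h5 h7.
Qed.

Lemma perp_ratio_first : (1 < D)%N ->
  - (q ^- 2 * Z ^+ 2 * E * (1 - q / Z) / (1 + E * Z / q ^+ 2)) * perp_ratio q
  = (Z - 1) * (Z / q - 1) * E * q * (1 + E * Z / q ^+ 2).
Proof.
move=> D_gt1; case: (ratio_conditions 1) => //; rewrite expr1.
case=> _ h1 h2 h3 h4 [h5 h6 h7].
rewrite /perp_ratio /ppos /pneg /wpos_ratio /wneg_ratio.
have g : q ^+ 2 + E * Z != 0 by rewrite -eZ.
by field; rewrite q0 E0 Z0 g h1 h2 h3 h4.
Qed.

(** The passage from x = D - 1 to x = D: the prefactor is c_(D-1) (-1/E;q)_(D-1), and 1 + Z / (q E)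
    is the last factor of 1 / w_{-D}. *)
Lemma sym_ratio_last : (1 < D)%N ->
  q * (1 - Z / q) / (1 + E * q ^+ 2 / Z) * sym_ratio (Z / q)
  * dqk_up q s D (Z / q) * (1 + Z / (q * E))
  = dqk_down q s D Z.
Proof.
move=> D_gt1.
have g1 : E - -1 * Z != 0 by have := qE D 0; rewrite eZ expr0; congr (_ != 0); ring.
have g2 : q * E - -1 * Z != 0 by have := qE D 1; rewrite eZ expr1; congr (_ != 0); ring.
have g3 : E * q ^+ 2 - -1 * Z != 0 by have := qE D 2; rewrite eZ; congr (_ != 0); ring.
have g4 : 1 + E * q != 0 by have := qE 0 1.
have g5 : Z * q - Z != 0 by rewrite -eZ -exprSr subqX_neq0 // gtn_eqF.
have g6 : q - Z != 0 by rewrite -eZ -[X in X - _]expr1 subqX_neq0 // ltn_eqF.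
rewrite /sym_ratio /wpos_ratio /wneg_ratio /dqk_down /dqk_up eZ /s.
by field; rewrite q0 E0 Z0 g1 g2 g3 g4 g5 g6.
Qed.

End WeightRatios.

Lemma nonneg_node_range (D x : nat) : (x < D)%N -> - D%:Z <= x%:Z < D%:Z.
Proof. by lia. Qed.

Lemma neg_node_range (D x : nat) : (x < D)%N -> - D%:Z <= Negz x < D%:Z.
Proof. by lia. Qed.

(** * The form on the dual polar graph *)

Section DualPolar.

Context (q D k : nat) (q_gt1 : (1 < q)%N) (D_gt2 : (2 < D)%N).

Local Notation Q := (qR q).
Local Notation E := (Qp q k 0 1).
Local Notation Z := (qR q ^+ D).
Local Notation s := (- (Z * E)^-1).
Local Notation t := (tau q D k).

(** * Powers of q with exponent a + b e *)

Lemma qR_gt0 : 0 < Q. Proof. by rewrite ltr0n ltnW. Qed.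
Let Q0 : Q != 0. Proof. exact: lt0r_neq0 qR_gt0. Qed.

Lemma q4_gt0 : 0 < q4 q.
Proof. by rewrite /q4 !sqrtC_gt0 qR_gt0. Qed.

Lemma q4X4 : q4 q ^+ 4 = Q.
Proof. by rewrite (exprM _ 2 2) /q4 !sqrtCK. Qed.

Lemma QpD a b a' b' : Qp q k (a + a') (b + b') = Qp q k a b * Qp q k a' b'.
Proof.
rewrite /Qp /qpow -expfzDr ?lt0r_neq0 ?q4_gt0 //; congr (_ ^ _); ring.
Qed.

Lemma QpE a b : Qp q k a b = Q ^ a * E ^ b.
Proof.
rewrite -q4X4 /Qp /qpow exprnP !exprz_exp -expfzDr ?lt0r_neq0 ?q4_gt0 //.
by congr (_ ^ _); ring.
Qed.

Lemma Qp_gt0 a b : 0 < Qp q k a b.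
Proof. exact: exprz_gt0 q4_gt0. Qed.

Lemma Qp_sub (a b : nat) : Qp q k (a%:Z - b%:Z) 0 = Q ^+ a / Q ^+ b.
Proof. by rewrite QpE expr0z mulr1 expfzDr ?Q0 // exprnN. Qed.

Lemma tau_sqr : tau q D k ^+ 2 = s.
Proof.
rewrite /tau exprMn sqrCi mulN1r; congr (- _).
have -> : Z * E = Qp q k D 1 by rewrite [RHS]QpE expr1z.
rewrite /Qp /qpow exprnP exprz_exp invr_expz; congr (_ ^ _); ring.
Qed.

Let Qn1 n : 1 - Q ^+ n.+1 != 0.
Proof.
have Q_gt1 : 1 < Q by rewrite /qR ltr1n.
by rewrite subr_eq0 Order.POrderTheory.lt_eqF // (exprn_egt1 n.+1 Q_gt1).
Qed.

Let qE a b : Q ^+ a + E * Q ^+ b != 0.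
Proof.
apply: lt0r_neq0; apply: addr_gt0; first exact: exprn_gt0 qR_gt0.
by apply: mulr_gt0; [exact: Qp_gt0 | exact: exprn_gt0 qR_gt0].
Qed.

Let E0 : E != 0. Proof. exact: lt0r_neq0 (Qp_gt0 _ _). Qed.

(** * The weights as multiples of c_x *)

Lemma poch_qpoch r n : poch q r n = qpoch Q r n. Proof. by []. Qed.

Lemma Qp_dec x : Qp q k (- x%:Z) 1 = E / Q ^+ x.
Proof. by rewrite QpE -exprnN expr1z mulrC. Qed.

Lemma Qp_dec1 x : Qp q k (1 - x.+1%:Z) 1 = E / Q ^+ x.
Proof. by rewrite -Qp_dec; congr Qp; lia. Qed.

Lemma Qp_sub1 a b : Qp q k (a%:Z - b%:Z) 1 = Q ^+ a / Q ^+ b * E.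
Proof. by rewrite -Qp_sub -QpD addr0 add0r. Qed.

Lemma Qp_mid x : Qp q k (D%:Z - 2 * x%:Z) 1 = Z / (Q ^+ x) ^+ 2 * E.
Proof. by rewrite -exprM -Qp_sub1; congr Qp; lia. Qed.

(** A form whose symbols, of lengths x and D - 1, also occur in w_(x+1) and w_{-(x+1)}, so that the
    ratios of the weights become rational identities. *)
Lemma cw_split x :
  cw q D k x.+1 = - ((-1) ^+ x * Qp q k (x.+1%:Z * (D%:Z - x.+1%:Z - 1) + D%:Z) x.+1
    * (qpoch Q (Q ^- D.-1) x * (1 - Q ^+ x / Q ^+ D.-1))
    / (qpoch Q Q x * qpoch Q (- (E / Q ^+ x)) D.-1
       * (1 + Z / (Q ^+ x.+1) ^+ 2 * E))).
Proof.
rewrite /cw !poch_qpoch !subn1 /= Qp_dec1 Qp_mid qpochS [(-1) ^+ x.+1]exprS.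
by rewrite [Q ^+ x / _]mulrC !mulN1r !mulNr.
Qed.

Lemma qpochE_neq0 x n : qpoch Q (- (E / Q ^+ x)) n != 0.
Proof.
rewrite /qpoch; apply/prodf_neq0 => i _.
have -> : 1 - - (E / Q ^+ x) * Q ^+ i = (Q ^+ x + E * Q ^+ i) / Q ^+ x.
  by field; rewrite expf_neq0 // Q0.
by rewrite mulf_neq0 ?qE // invr_eq0 expf_neq0 // Q0.
Qed.

Let D_gt0 : (0 < D)%N. Proof. by rewrite ltnW // ltnW. Qed.

Let QD1 : Q ^+ D.-1 = Z / Q.
Proof. by rewrite -[in RHS](prednK (ltnW (ltnW D_gt2))) exprSr mulfK // Q0. Qed.

Let QX0 n : Q ^+ n != 0. Proof. by rewrite expf_neq0 // Q0. Qed.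

Let Qpoch0 n : qpoch Q Q n != 0.
Proof. exact: (qpochq_neq0 _ Qn1). Qed.

Lemma Qp_mid_neq0 x : 1 + Z / (Q ^+ x) ^+ 2 * E != 0.
Proof.
have -> : 1 + Z / (Q ^+ x) ^+ 2 * E = (Q ^+ (x * 2) + E * Z) / Q ^+ (x * 2).
  by rewrite exprM; field; exact: QX0.
by rewrite mulf_neq0 ?invr_eq0 ?qE.
Qed.

Lemma qpochE_shift x n :
  qpoch Q (- (E / Q ^+ x.+1)) n.+1 = (1 + E / Q ^+ x.+1) * qpoch Q (- (E / Q ^+ x)) n.
Proof.
rewrite qpochSl opprK; congr (_ * qpoch _ _ _).
by rewrite exprS; field; rewrite QX0 Q0.
Qed.

Lemma wpos_cw x : (0 < x < D)%N ->
  wpos q D k x = cw q D k x * wpos_ratio E Z (Q ^+ x).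
Proof.
case: x => // x hx; rewrite cw_split /wpos_ratio /wpos !poch_qpoch !subn1.
rewrite Qp_dec Qp_mid Qp_sub Qp_sub1.
have -> : Qp q k (x.+1%:Z * (D%:Z - x.+1%:Z)) x.+1%:Z
   = Qp q k (x.+1%:Z * (D%:Z - x.+1%:Z - 1) + D%:Z) x.+1 * (Q ^+ x.+1 / Z).
  by rewrite -Qp_sub -QpD; congr Qp; ring.
rewrite -[in qpoch _ _ D](prednK (ltnW (ltnW D_gt2))) qpochE_shift !qpochS.
rewrite [(-1) ^+ x.+1]exprS.
have := Qp_mid_neq0 x.+1; have := qpochE_neq0 x D.-1; have := Qpoch0 x.
case: (ratio_conditions Q E Z D Q0 Qn1 qE erefl x.+1) => //.
have := QX0 D; rewrite QD1 ![Q ^+ x.+1]exprS.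
have := QX0 x; have := Q0; have := E0.
move: (Qp _ _ (_ + _) _) (qpoch _ _ _) (qpoch _ _ _) (qpoch _ _ _) => P A B C.
move: (Q) (E) (Z) (Q ^+ x) ((-1) ^+ x) => u e z y n e0 u0 y0 z0.
move=> [_ h1 h2 h3 h4] [h5 h6 h7] A0 C0 g.
have g' : (u * y) ^+ 2 + z * e != 0.
  by have := h5; congr (_ != 0); ring.
by field; rewrite y0 u0 h3 h1 z0 g' C0 A0.
Qed.

Lemma wneg_cw x : (0 < x < D)%N ->
  wneg q D k x = cw q D k x * wneg_ratio E Z (Q ^+ x).
Proof.
case: x => // x hx; rewrite cw_split /wneg_ratio /wneg !poch_qpoch !subn1.
rewrite Qp_dec1 Qp_mid [x.+1.-1]/=.
have -> : Qp q k (x.+1%:Z * (D%:Z - x.+1%:Z - 2) + D%:Z) (x.+1%:Z + 1)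
   = Qp q k (x.+1%:Z * (D%:Z - x.+1%:Z - 1) + D%:Z) x.+1 * (Q ^+ 0 / Q ^+ x.+1 * E).
  by rewrite -Qp_sub1 -QpD; congr Qp; ring.
have -> : Qp q k x.+1 (-1) = Q ^+ x.+1 / E by rewrite QpE exprN1.
have -> n : qpoch Q n D = qpoch Q n D.-1 * (1 - n * Q ^+ D.-1).
  by rewrite -[in LHS](prednK (ltnW (ltnW D_gt2))) qpochS.
have := Qp_mid_neq0 x.+1; have := qpochE_neq0 x D.-1; have := Qpoch0 x.
case: (ratio_conditions Q E Z D Q0 Qn1 qE erefl x.+1) => //.
have := QX0 D; rewrite QD1 ![Q ^+ x.+1]exprS expr0.
have := QX0 x; have := Q0; have := E0.
move: (Qp _ _ (_ + _) _) (qpoch _ _ _) (qpoch _ _ _) (qpoch _ _ _) => P A B C.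
move: (Q) (E) (Z) (Q ^+ x) ((-1) ^+ x) => u e z y n e0 u0 y0 z0.
move=> [_ h1 h2 h3 h4] [h5 h6 h7] A0 C0 g.
have g' : (u * y) ^+ 2 + z * e != 0.
  by have := h5; congr (_ != 0); ring.
by field; rewrite y0 u0 h4 h2 e0 g' C0 A0 z0.
Qed.

Lemma cw_next x : (0 < x)%N -> (x.+1 < D)%N ->
  cw q D k x.+1 = cw q D k x * cw_step Q E Z (Q ^+ x).
Proof.
case: x => // y _ hx; rewrite !cw_split /cw_step.
have -> : Qp q k (y.+2%:Z * (D%:Z - y.+2%:Z - 1) + D%:Z) y.+2
   = Qp q k (y.+1%:Z * (D%:Z - y.+1%:Z - 1) + D%:Z) y.+1
     * (Q ^+ D / Q ^+ (y.+2 * 2) * E).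
  by rewrite -Qp_sub1 -QpD; congr Qp; rewrite ?PoszM; ring.
have [d eD] : exists d, D.-1 = d.+1 by exists D.-2; lia.
have eqD : Q ^+ d = Z / Q ^+ 2.
  by rewrite (_ : D = d + 2)%N ?exprD ?mulfK //; lia.
have eqD1 := QD1; rewrite eD in eqD1.
rewrite !eD qpochE_shift !qpochS eqD eqD1 exprM.
have := Qp_mid_neq0 y.+1; have := Qp_mid_neq0 y.+2.
have := qpochE_neq0 y D.-1; rewrite eD qpochS mulf_eq0 negb_or eqD => /andP[].
have := Qpoch0 y.
case: (ratio_conditions Q E Z D Q0 Qn1 qE erefl y.+1).
  by lia.
case: (ratio_conditions Q E Z D Q0 Qn1 qE erefl y.+2) => //.
have := QX0 D; rewrite ![Q ^+ y.+2]exprS ![Q ^+ y.+1]exprS ![(-1) ^+ y.+1]exprS.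
have := QX0 y; have := Q0; have := E0.
move: (Qp _ _ (_ + _) _) (qpoch _ _ _) (qpoch _ _ _) (qpoch _ _ _) => P A B C.
move: (Q) (E) (Z) (Q ^+ y) ((-1) ^+ y) => u e z y' n e0 u0 y0 z0.
move=> [_ h1 h2 h3 h4] [h5 h6 h7] [_ f1 f2 f3 f4] [f5 f6 f7] A0 C0 d1 d2 d3.
have g1 : (u * y' * u) ^+ 2 + e * z != 0.
  by have := h5; congr (_ != 0); ring.
have g2 : (u * y') ^+ 2 + z * e != 0.
  by have := f5; congr (_ != 0); ring.
have g3 : y' * u ^+ 2 - - e * z != 0.
  by have := h4; congr (_ != 0); ring.
by field; rewrite u0 y0 g1 f3 f1 g2 g3 C0 A0 z0.
Qed.

Lemma cw_first :
  cw q D k 1 = - (Q ^- 2 * Z ^+ 2 * E * (1 - Q / Z) / (1 + E * Z / Q ^+ 2))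
               / qpoch Q (- E) D.-1.
Proof.
rewrite cw_split !qpoch0 !expr0 divr1 QD1 expr1.
have -> : Qp q k (1 * (D%:Z - 1 - 1) + D%:Z) 1 = Q ^+ (D * 2) / Q ^+ 2 * E.
  by rewrite -Qp_sub1; congr Qp; lia.
have := Qp_mid_neq0 1; have := qpochE_neq0 0 D.-1; rewrite expr0 divr1 expr1 exprM.
have := QX0 D; have := Q0; move: (qpoch _ _ _) => P.
move: (Q) (E) (Z) => u e z u0 z0 P0 g.
have g' : u ^+ 2 + e * z != 0.
  have -> : u ^+ 2 + e * z = u ^+ 2 * (1 + z / u ^+ 2 * e) by field.
  by rewrite mulf_neq0 ?expf_neq0.
by field; rewrite u0 z0 P0 g'.
Qed.

Lemma cw_last :
  cw q D k D.-1 = Q * (1 - Z / Q) / (1 + E * Q ^+ 2 / Z) / qpoch Q (- E^-1) D.-1.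
Proof.
have [d eD] : exists d, D.-1 = d.+1 by exists D.-2; lia.
have eqD1 := QD1; rewrite eD in eqD1.
rewrite eD cw_split eD.
have -> : Qp q k (d.+1%:Z * (D%:Z - d.+1%:Z - 1) + D%:Z) d.+1 = Z * E ^+ d.+1.
  rewrite QpE -!exprnP (_ : _ * _ + _ = D%:Z) //; lia.
(* Both symbols of length d + 1 are brought to the form of [qpoch_reverse], with r = q and r = -1/E.
   The two products of the q^i then cancel, and the symbol (-1/E;q)_(D-1) of w_{-D} appears. *)
have -> : qpoch Q (Q ^- d.+1) d * (1 - Q ^+ d / Q ^+ d.+1) = qpoch Q (Q^-1 / Q ^+ d) d.+1.
  by rewrite qpochS -invfM -exprS [Q ^+ d / _]mulrC.
have -> : - (E / Q ^+ d) = (- E^-1)^-1 / Q ^+ d by rewrite invrN invrK mulNr.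
have iE0 : - E^-1 != 0 by rewrite oppr_eq0 invr_eq0 E0.
have Pn : qpoch Q (- E^-1) d.+1 != 0.
  rewrite /qpoch; apply/prodf_neq0 => i _.
  have -> : 1 - - E^-1 * Q ^+ i = (Q ^+ i + E * Q ^+ 0) / E.
    by rewrite expr0; field; exact: E0.
  by rewrite mulf_neq0 ?qE // invr_eq0 E0.
rewrite !qpoch_reverse ?Q0 // qpochS -exprS opprK [(- Q) ^+ _]exprNn eqD1.
have T0 : \prod_(i < d.+1) Q ^+ i != 0 by apply/prodf_neq0.
have := Qp_mid_neq0 d.+1; rewrite eqD1 exprVn.
have := Qpoch0 d; have := QX0 D; have := Q0; have := E0.
have := expf_neq0 d.+1 E0; have := signr_eq0 algC d.
move: Pn T0; rewrite [(-1) ^+ d.+1]exprS; have := qE D 2.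
move: (\prod_(i < _) _) (qpoch _ _ _) (qpoch _ _ _) => T A B.
move: (Q) (E ^+ d.+1) (E) (Z) ((-1) ^+ d) => u e' e z n g2 A0 T0 n0 e'0 e0 u0 z0 B0 g.
by field; rewrite A0 z0 g2 u0 e'0 T0 B0 n0.
Qed.

(** * Identification with the dual q-Krawtchouk weights *)

Let s0 : s != 0. Proof. by rewrite oppr_eq0 invr_eq0 mulf_neq0. Qed.
Let Qs a b : Q ^+ a - s * Q ^+ b != 0.
Proof. by apply: (ratio_params_neq0 _ _ _ D) => //; apply: qE. Qed.
Let Qs2 a b : Q ^+ a - (s * Q ^+ 2) * Q ^+ b != 0.
Proof. by rewrite -mulrA -exprD. Qed.
Let sQ20 : s * Q ^+ 2 != 0. Proof. by rewrite mulf_neq0. Qed.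
Let t0 : t != 0.
Proof. by apply/eqP => t0; move: s0; rewrite -tau_sqr // t0 expr0n eqxx. Qed.

Let QD2 : Q ^+ (D - 2) = Z / Q ^+ 2.
Proof. by rewrite -[in RHS](subnK (ltnW D_gt2)) exprD mulfK. Qed.

Lemma dqk_wt0 : dqk_wt Q s D 0 = w0 q D k.
Proof.
rewrite /dqk_wt big_ord0 mulr1 /w0 poch_qpoch invrN invrK.
by congr (qpoch _ _ _)^-1; field; exact: QX0.
Qed.

(** Both sides obey the same first-order recurrence, started at x = 1 from the value w_0 at x =
    0. *)
Lemma sym_ratio_wt x : (0 < x < D)%N ->
  cw q D k x * sym_ratio E Z (Q ^+ x) = dqk_wt Q s D x.
Proof.
elim: x => // -[_ _|x IH /andP[_ lt_xD]].
  have hd := dqk_down_neq0 Q s D Q0 Qn1 s0 Qs 0 D_gt0.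
  apply: (mulIf hd); rewrite dqk_wtS // dqk_wt0 expr0 !expr1 cw_first //.
  set P := qpoch _ _ D.-1; rewrite [_ / P * _]mulrAC [_ / P * _]mulrAC.
  rewrite (sym_ratio_first _ _ _ D) ?(ltnW D_gt2) //.
  rewrite /w0 poch_qpoch -[in qpoch _ _ D](prednK D_gt0) qpochS -/P QD1.
  by rewrite mulNr opprK [E * (Z / Q)]mulrA -[LHS]mulrA -invfM mulrC [P * _]mulrC.
have hd := dqk_down_neq0 Q s D Q0 Qn1 s0 Qs x.+1 (ltnW lt_xD).
apply: (mulIf hd); rewrite dqk_wtS ?(ltnW lt_xD) // -IH ?(ltnW lt_xD) // cw_next //.
rewrite (exprS Q x.+1) -[LHS]mulrA -[LHS]mulrA [cw_step _ _ _ _ * _]mulrA.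
by rewrite (sym_ratio_step _ _ _ D) // mulrA.
Qed.

Lemma wmD_wt : wmD q D k = dqk_wt Q s D D.
Proof.
have lt_D1D : (D.-1 < D)%N by rewrite prednK.
have hd := dqk_down_neq0 Q s D Q0 Qn1 s0 Qs _ lt_D1D.
apply: (mulIf hd); have := dqk_wtS Q s D Q0 Qn1 s0 Qs _ lt_D1D.
rewrite prednK // => ->.
have <- := sym_ratio_wt D.-1; last by lia.
rewrite cw_last // QD1 -(sym_ratio_last _ _ _ D) ?(ltnW D_gt2) //.
rewrite /wmD poch_qpoch -[in qpoch _ _ D](prednK D_gt0) qpochS QD1.
have -> : Qp q k 0 (-1) = E^-1 by rewrite QpE // expr0z mul1r exprN1.
have nz : 1 + Z / (Q * E) != 0.
  have -> : 1 + Z / (Q * E) = (Q ^+ D + E * Q ^+ 1) / (Q * E).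
    by rewrite expr1; field; rewrite Q0 E0.
  by rewrite mulf_neq0 // invr_eq0 mulf_neq0.
rewrite mulNr opprK [E^-1 * _]mulrC -[Z / Q / E]mulrA -invfM.
move: nz; set n := 1 + _ => nz; set P := qpoch _ _ _.
rewrite [P * n]mulrC invfM [LHS]mulrC !mulrA mulfK //; ring.
Qed.

(** The factor between the weight induced on multiples of p^perp / tau and the normalized weight of
    diameter D - 2, read off at x = 1 from [perp_ratio_first]. *)
Definition perp_const : algC := (Z - 1) * (Z / Q - 1) * E * Q.

Lemma perp_ratio_wt x : (0 < x < D)%N ->
  cw q D k x * perp_ratio E Z (Q ^+ x)
  = perp_const * dqk_wt Q (s * Q ^+ 2) (D - 2) x.-1.
Proof.
elim: x => // -[_ _|x IH /andP[_ lt_xD]].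
  rewrite /dqk_wt big_ord0 mulr1 QD2 cw_first //.
  set P := qpoch _ _ D.-1; rewrite [_ / P * _]mulrAC expr1.
  rewrite (perp_ratio_first _ _ _ D) ?(ltnW D_gt2) // -/perp_const.
  have -> : (s * Q ^+ 2)^-1 / (Z / Q ^+ 2) = - E.
    by field; rewrite Q0 E0 QX0.
  have nz : 1 + E * Z / Q ^+ 2 != 0.
    have -> : 1 + E * Z / Q ^+ 2 = (Q ^+ 2 + E * Q ^+ D) / Q ^+ 2 by field.
    by rewrite mulf_neq0 // invr_eq0.
  rewrite /P (_ : D.-1 = (D - 2).+1) ?qpochS ?QD2; last by lia.
  rewrite mulNr opprK [E * (Z / _)]mulrA; move: nz; set n := 1 + _ => nz.
  by rewrite -mulrA [_ * n]mulrC invfM mulVKf.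
have lt_xD2 : (x < D - 2)%N by lia.
have hd := dqk_down_neq0 Q _ (D - 2) Q0 Qn1 sQ20 Qs2 x lt_xD2.
apply: (mulIf hd); rewrite -[RHS]mulrA [_.-1]/= dqk_wtS // [RHS]mulrA.
have := IH _; rewrite /= => <-; last by lia.
rewrite cw_next // (exprS Q x.+1) -[LHS]mulrA -[LHS]mulrA [cw_step _ _ _ _ * _]mulrA.
rewrite (perp_ratio_step _ _ _ D) //.
by rewrite mulrA [in _ / Q]exprSr mulfK.
Qed.

(** * Values of h_i, h^perp_i and ell at the nodes *)

Lemma hfun_dqk r d i x eta : (i <= d)%N ->
  (r / eta = Q ^- x /\ r * eta = r ^+ 2 * Q ^+ x) \/
  (r / eta = r ^+ 2 * Q ^+ x /\ r * eta = Q ^- x) ->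
  hfun q r d i eta = qpoch Q (Q ^- d) i / r ^+ i * dqk Q (r ^+ 2) d i x.
Proof.
move=> le_id eta_x; rewrite /hfun !poch_qpoch; congr (_ * _).
pose f n := poch q (Q ^- i) n * poch q (r / eta) n * poch q (r * eta) n
  / (poch q 0 n * poch q (Q ^- d) n) * Q ^+ n / poch q Q n.
(* The series stops at i and the sum in [dqk] at d; the terms in between contain (q^-i;q)_n with n >
   i, which is zero. *)
rewrite /dqk (big_ord_widen d.+1 f) ?ltnS // /f.
rewrite big_mkcond; apply: eq_bigr => n _.
have -> : poch q 0 n = 1 by rewrite /poch big1 // => m _; rewrite mul0r subr0.
rewrite /dqk_coef /dqk_base !poch_qpoch mul1r; case: ifP => [_|/negbT].
  rewrite invfM; case: eta_x => -[-> ->]; ring.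
by rewrite -leqNgt => lt_in; rewrite (qpoch_eq0 _ _ _ Q0 lt_in) !mul0r.
Qed.

(** The two nodes of index x are mutually inverse. Inverting eta only exchanges t / eta and t eta in
    the series, so one value serves for both nodes. *)
Definition at_node (x : nat) (eta : algC) : Prop :=
  eta = t * Q ^+ x \/ eta = t^-1 * Q ^- x.

Lemma hh_dqk i x eta : (i <= D)%N -> at_node x eta ->
  hh q D k i eta = qpoch Q (Q ^- D) i / t ^+ i * dqk Q s D i x.
Proof.
move=> le_iD node; rewrite -tau_sqr //.
apply: hfun_dqk => //; case: node => ->; [left|right]; split; field; by rewrite ?t0 ?QX0.
Qed.

(* For i = D - 1 both sides vanish: the left one at every node lambda_x and
   lambda_{-x} with 0 < x < D, the right one through [qpoch _ _ i]. *)
Lemma hperp_dqk i x eta : (i < D)%N -> (0 < x < D)%N -> at_node x eta ->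
  hperp q D k i eta = qpoch Q (Q ^- (D - 2)) i / (t * Q) ^+ i
                      * dqk Q (s * Q ^+ 2) (D - 2) i x.-1.
Proof.
move=> lt_iD /andP[x_gt0 lt_xD] node; rewrite /hperp; case: eqP => [->|ne].
  rewrite (@qpoch_eq0 _ Q (D - 2)) //; last by lia.
  have -> : \prod_(1 <= n < D) ((eta - t * Q ^+ n) * (eta - t^-1 / Q ^+ n)) = 0.
    rewrite (bigD1_seq x) ?mem_index_iota ?x_gt0 ?iota_uniq //=.
    by case: node => ->; rewrite subrr ?mul0r ?mulr0 ?mul0r.
  by rewrite mulr0 !mul0r.
rewrite -tau_sqr // -exprMn.
apply: hfun_dqk; first by lia.
have ex : Q ^+ x = Q * Q ^+ x.-1 by rewrite -exprS prednK.
rewrite /at_node ex in node.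
by case: node => ->; [left|right]; split; field; rewrite ?t0 ?QX0 ?Q0.
Qed.

Definition sym_idx (mu : bool) (i : nat) : nat := if mu then i.+1 else i.
Definition perp_idx (mu : bool) (i : nat) : nat := if mu then i else i.-1.

(** The powers of tau in ell combine with those in h, h^perp and p^perp to powers of s = tau^2, so
    that these coefficients are real although tau is not. *)
Definition sym_coef (mu : bool) (i : nat) : algC :=
  if mu then qpoch Q (Q ^- D) i.+1 / (s ^+ i.+1 * (1 - Z) * qpoch Q Q i)
  else (Z - Q ^+ i) * qpoch Q (Q ^- D) i / (s ^+ i * (Z - 1) * qpoch Q Q i).

(** For [mu = false] and i = 0 the factor 1 - q^0 encodes h^perp_{-1} = 0; the truncated index
    [i.-1] is then a harmless default. *)
Definition perp_coef (mu : bool) (i : nat) : algC :=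
  if mu then - (qpoch Q (Q ^- (D - 2)) i / (Q ^+ i * s ^+ i * (1 - Z) * qpoch Q Q i))
  else - ((1 - Q ^+ i) * qpoch Q (Q ^- (D - 2)) i.-1
          / (Q ^+ i.-1 * s ^+ i.-1 * (Z - 1) * qpoch Q Q i)).

Let Z10 : Z - 1 != 0.
Proof. by rewrite -oppr_eq0 opprB -(prednK D_gt0). Qed.

(** The alternative p = 0 serves the unpaired nodes x = 0 and x = D, where p^perp vanishes and x - 1
    is no point of the polynomials of diameter D - 2. *)
Lemma ell_node mu i x eta p : (i < D)%N -> at_node x eta ->
  pperp q D k eta = t * p -> (0 < x < D)%N \/ p = 0 ->
  ell q D k mu i eta = sym_coef mu i * dqk Q s D (sym_idx mu i) x
    + perp_coef mu i * p * dqk Q (s * Q ^+ 2) (D - 2) (perp_idx mu i) x.-1.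
Proof.
move=> lt_iD node eta_p x_p.
have perp j : (j < D)%N -> pperp q D k eta * hperp q D k j eta
   = t * p * (qpoch Q (Q ^- (D - 2)) j / (t * Q) ^+ j
              * dqk Q (s * Q ^+ 2) (D - 2) j x.-1).
  move=> lt_jD; rewrite eta_p.
  by case: x_p => [hx|->]; [rewrite (hperp_dqk _ x) | rewrite mulr0 !mul0r].
have Z1' : 1 - Z != 0 by rewrite -opprB oppr_eq0.
have sX n : s ^+ n = t ^+ n * t ^+ n by rewrite -tau_sqr // expr2 exprMn.
have hK := hh_dqk _ _ _ _ node.
rewrite /ell /sym_idx /perp_idx; case: mu.
  rewrite /ellp perp // hK // /sym_coef /perp_coef !poch_qpoch !sX [(t * Q) ^+ i]exprMn.
  rewrite ![t ^+ i.+1]exprS.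
  have := Qpoch0 i; have := QX0 i; have := expf_neq0 i t0; have := t0.
  move: (dqk _ _ _ _ _) (dqk _ _ _ _ _) (qpoch _ _ i.+1) (qpoch _ _ i) (qpoch _ _ i).
  move: (t ^+ i) t (Q ^+ i) => ti u qi a b c d e u0 ti0 qi0 e0.
  by field; rewrite u0 ti0 qi0 e0 Z1'.
rewrite /ellm hK ?(ltnW lt_iD) // /sym_coef /perp_coef !poch_qpoch.
case: i lt_iD => [|i] lt_iD.
  by rewrite expr0 subrr !mul0r subr0 oppr0 !mul0r addr0 mulrA; congr (_ * _);
    rewrite !qpoch0 !expr0; field; exact: Z10.
have ZQ : Z - Q ^+ i.+1 != 0 by rewrite subqX_neq0 // gtn_eqF.
rewrite -[_ / _ * _ * hperp_pred _ _ _ _ _]mulrA perp ?(ltnW lt_iD) // !sX.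
rewrite [(t * Q) ^+ _]exprMn [_.+1.-1]/= ![t ^+ i.+1]exprS.
have := Qpoch0 i.+1; have := QX0 i; have := expf_neq0 i t0; have := t0; move: ZQ Z10.
move: (dqk _ _ _ _ _) (dqk _ _ _ _ _) (qpoch _ _ i.+1) (qpoch _ _ i.+1) (qpoch _ _ i).
move: (t ^+ i) t (Q ^+ i) (Q ^+ i.+1) => ti u qi qi1 a b c d e ZQ Z10' u0 ti0 qi0 e0.
by field; rewrite e0 Z10' ti0 qi0 u0 ZQ.
Qed.

Lemma pperp_pos x : pperp q D k (t * Q ^+ x) = t * ppos E (Q ^+ x).
Proof.
have -> : pperp q D k (t * Q ^+ x)
  = t * ((Q ^+ x - 1) * (1 - (t ^+ 2)^-1 * Q ^- D / Q ^+ x)).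
  by rewrite /pperp; field; rewrite t0 !QX0.
rewrite tau_sqr // /ppos; field; rewrite !QX0 E0 //.
Qed.

Lemma pperp_neg x : pperp q D k (t^-1 * Q ^- x) = t * pneg E Z (Q ^+ x).
Proof.
have -> : pperp q D k (t^-1 * Q ^- x)
  = t * (((t ^+ 2)^-1 * Q ^- x - 1) * (1 - Q ^+ x / Z)).
  by rewrite /pperp; field; rewrite t0 !QX0.
rewrite tau_sqr // /pneg; field; rewrite !QX0 E0 //.
Qed.

(** * Reality of the values at the nodes *)

Let Q_real : Q \is Num.real. Proof. exact: realn. Qed.
Let E_real : E \is Num.real. Proof. by rewrite gtr0_real // Qp_gt0. Qed.
Let s_real : s \is Num.real.
Proof. by rewrite rpredN rpredV rpredM // rpredX. Qed.
Let sQ2_real : s * Q ^+ 2 \is Num.real. Proof. by rewrite rpredM // rpredX. Qed.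

Lemma qpoch_real r n : r \is Num.real -> qpoch Q r n \is Num.real.
Proof. by move=> r_real; apply: rpred_prod => i _; rewrite rpredB ?rpred1 ?rpredM ?rpredX. Qed.

Ltac num_real := repeat first
  [ assumption | exact: rpred1 | rewrite rpredN | apply: rpredM | apply: rpredB | apply: rpredD
  | rewrite rpredV | apply: rpredX
  | apply: qpoch_real ].

Lemma dqk_real r N n x : r \is Num.real -> dqk Q r N n x \is Num.real.
Proof.
move=> r_real; apply: rpred_sum => j _; rewrite /dqk_coef /dqk_base.
by num_real.
Qed.

Lemma sym_coef_real mu i : sym_coef mu i \is Num.real.
Proof.
by case: mu; rewrite /sym_coef; num_real.
Qed.

Lemma perp_coef_real mu i : perp_coef mu i \is Num.real.
Proof.
by case: mu; rewrite /perp_coef; num_real.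
Qed.

Lemma ppos_real x : ppos E (Q ^+ x) \is Num.real.
Proof. by rewrite /ppos; num_real. Qed.

Lemma pneg_real x : pneg E Z (Q ^+ x) \is Num.real.
Proof. by rewrite /pneg; num_real. Qed.

Lemma ell_pos mu i x : (i < D)%N -> (x < D)%N ->
  ell q D k mu i (lam q D k x) = sym_coef mu i * dqk Q s D (sym_idx mu i) x
    + perp_coef mu i * ppos E (Q ^+ x)
      * dqk Q (s * Q ^+ 2) (D - 2) (perp_idx mu i) x.-1.
Proof.
move=> lt_iD lt_xD; apply: ell_node => //; [by left | exact: pperp_pos |].
case: x lt_xD => [_|x lt_xD]; [right | by left].
by rewrite /ppos expr0 subrr mul0r.
Qed.

Lemma ell_neg mu i x : (i < D)%N -> (x < D)%N ->
  ell q D k mu i (lam q D k (Negz x)) = sym_coef mu i * dqk Q s D (sym_idx mu i) x.+1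
    + perp_coef mu i * pneg E Z (Q ^+ x.+1)
      * dqk Q (s * Q ^+ 2) (D - 2) (perp_idx mu i) x.
Proof.
move=> lt_iD lt_xD; apply: (ell_node _ _ x.+1) => //; [by right | exact: pperp_neg |].
move: lt_xD; rewrite leq_eqVlt => /orP[/eqP->|lt_xD]; [right | by left].
by rewrite /pneg divff // subrr mulr0 oppr0.
Qed.

Lemma ell_conj mu i z : (i < D)%N -> (- D%:Z <= z < D%:Z) ->
  (ell q D k mu i (lam q D k z))^* = ell q D k mu i (lam q D k z).
Proof.
move=> lt_iD z_range; apply: conj_Creal.
have c1 := sym_coef_real mu i; have c2 := perp_coef_real mu i.
case: z z_range => x z_range.
  move: z_range => /andP[_]; rewrite ltz_nat => lt_xD; rewrite ell_pos //.
  apply: rpredD; first by apply: rpredM => //; apply: dqk_real.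
  apply: rpredM; last exact: dqk_real.
  by apply: rpredM => //; apply: ppos_real.
move: z_range => /andP[+ _]; rewrite NegzE lerN2 lez_nat => lt_xD; rewrite ell_neg //.
apply: rpredD; first by apply: rpredM => //; apply: dqk_real.
  apply: rpredM; last exact: dqk_real.
  by apply: rpredM => //; apply: pneg_real.
Qed.

(** * Evaluation of the form on the functions ell *)

Lemma sum_centered (G : int -> algC) :
  \sum_(n < 2 * D) G (n%:Z - D%:Z)
  = G 0 + \sum_(1 <= x < D) (G x%:Z + G (- x%:Z)) + G (- D%:Z).
Proof.
have -> : (2 * D = D + D)%N by rewrite mul2n addnn.
rewrite big_split_ord /= (reindex_inj rev_ord_inj) /=.
have -> : \sum_(j < D) G ((D - j.+1)%:Z - D%:Z)
  = \sum_(1 <= x < D) G (- x%:Z) + G (- D%:Z).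
  transitivity (\sum_(1 <= x < D.+1) G (- x%:Z)); last by rewrite big_nat_recr.
  rewrite big_add1 big_mkord; apply: eq_bigr => j _.
  by rewrite -subzn ?ltn_ord // addrAC subrr add0r.
have -> : \sum_(j < D) G ((D + j)%:Z - D%:Z) = G 0 + \sum_(1 <= x < D) G x.
  rewrite -big_ltn // big_mkord; apply: eq_bigr => j _.
  by rewrite PoszD addrAC subrr add0r.
rewrite !big_split /=; ring.
Qed.

Lemma formL_ell mu nu i j : (i < D)%N -> (j < D)%N ->
  formL q D k (ell q D k mu i) (ell q D k nu j) =
  sym_coef mu i * sym_coef nu j *
    \sum_(x < D.+1) dqk Q s D (sym_idx mu i) x * dqk Q s D (sym_idx nu j) x
                    * dqk_wt Q s D x
  + perp_const * (perp_coef mu i * perp_coef nu j) *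
    \sum_(x < (D - 2).+1) dqk Q (s * Q ^+ 2) (D - 2) (perp_idx mu i) x
       * dqk Q (s * Q ^+ 2) (D - 2) (perp_idx nu j) x
       * dqk_wt Q (s * Q ^+ 2) (D - 2) x.
Proof.
move=> lt_iD lt_jD; rewrite /formL.
set f := ell q D k mu i; set g := ell q D k nu j.
rewrite (sum_centered (fun z => f (lam q D k z) * (g (lam q D k z))^* * wt q D k z)).
rewrite addrAC -[_ + _ + \sum_(1 <= x < D) _]addrA -big_split.
set al := sym_coef _ _; set al' := sym_coef nu _.
set be := perp_coef _ _; set be' := perp_coef nu _.
pose F x := dqk Q s D (sym_idx mu i) x * dqk Q s D (sym_idx nu j) x * dqk_wt Q s D x.
pose H x := dqk Q (s * Q ^+ 2) (D - 2) (perp_idx mu i) x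
  * dqk Q (s * Q ^+ 2) (D - 2) (perp_idx nu j) x * dqk_wt Q (s * Q ^+ 2) (D - 2) x.
have -> : \sum_(x < D.+1) dqk Q s D (sym_idx mu i) x * dqk Q s D (sym_idx nu j) x
    * dqk_wt Q s D x = F 0%N + \sum_(1 <= x < D) F x + F D.
  by rewrite -(big_mkord xpredT F) big_nat_recr //= big_ltn.
have -> : \sum_(x < (D - 2).+1) dqk Q (s * Q ^+ 2) (D - 2) (perp_idx mu i) x
    * dqk Q (s * Q ^+ 2) (D - 2) (perp_idx nu j) x
    * dqk_wt Q (s * Q ^+ 2) (D - 2) x = \sum_(1 <= x < D) H x.-1.
  by rewrite big_add1 big_mkord (_ : D.-1 = (D - 2).+1) //; lia.
have fpos x : (x < D)%N -> f (lam q D k x) = al * dqk Q s D (sym_idx mu i) x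
    + be * ppos E (Q ^+ x) * dqk Q (s * Q ^+ 2) (D - 2) (perp_idx mu i) x.-1.
  exact: ell_pos.
have fneg x : (0 < x <= D)%N -> f (lam q D k (- x%:Z)) = al * dqk Q s D (sym_idx mu i) x
    + be * pneg E Z (Q ^+ x) * dqk Q (s * Q ^+ 2) (D - 2) (perp_idx mu i) x.-1.
  by case: x => // x; exact: ell_neg.
have gpos x : (x < D)%N -> (g (lam q D k x))^* = al' * dqk Q s D (sym_idx nu j) x
    + be' * ppos E (Q ^+ x) * dqk Q (s * Q ^+ 2) (D - 2) (perp_idx nu j) x.-1.
  by move=> lt_xD; rewrite ell_conj ?ell_pos // nonneg_node_range.
have gneg x : (0 < x <= D)%N -> (g (lam q D k (- x%:Z)))^* = al' * dqk Q s D (sym_idx nu j) x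
    + be' * pneg E Z (Q ^+ x) * dqk Q (s * Q ^+ 2) (D - 2) (perp_idx nu j) x.-1.
  by case: x => // x lt_xD; rewrite ell_conj ?ell_neg // neg_node_range.
have -> : f (lam q D k 0) * (g (lam q D k 0))^* * wt q D k 0 = al * al' * F 0%N.
  rewrite (fpos 0%N) // (gpos 0%N) // /F dqk_wt0 //= /ppos expr0 subrr; ring.
have -> : f (lam q D k (- D%:Z)) * (g (lam q D k (- D%:Z)))^* * wt q D k (- D%:Z)
   = al * al' * F D.
  have -> : wt q D k (- D%:Z) = dqk_wt Q s D D.
    by rewrite -wmD_wt // -[in - D%:Z](prednK D_gt0) /= prednK // eqxx.
  rewrite fneg ?gneg ?D_gt0 ?leqnn // /F /pneg divff // subrr; ring.
rewrite (eq_big_nat _ _ (F2 := fun x => al * al' * F x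
   + perp_const * (be * be') * H x.-1)).
  by rewrite big_split /= -!mulr_sumr; ring.
move=> x x_range; have [x_gt0 lt_xD] := andP x_range.
have le_x : (0 < x <= D)%N by rewrite x_gt0 ltnW.
rewrite fpos // gpos // fneg // gneg //.
have -> : wt q D k x = wpos q D k x by case: (x) x_gt0.
have -> : wt q D k (- x%:Z) = wneg q D k x.
  by case: x x_gt0 lt_xD {x_range le_x} => //= x _ lt_xD; rewrite ltn_eqF.
rewrite wpos_cw // wneg_cw //.
rewrite /F /H -(sym_ratio_wt) //.
rewrite [perp_const * _]mulrC.
have Hw := perp_ratio_wt x x_range.
have Hc := cross_ratio Q E Z D Q0 Qn1 E0 qE erefl x x_range.
rewrite /= in Hc.
set c := cw q D k x in Hw *; set wp := wpos_ratio E Z _ in Hc *.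
set wn := wneg_ratio E Z _ in Hc *; set pp := ppos E _ in Hc *.
set pn := pneg E Z _ in Hc *.
set A := dqk Q s D (sym_idx mu i) x; set A' := dqk Q s D (sym_idx nu j) x.
set B := dqk Q _ (D - 2) (perp_idx mu i) x.-1.
set B' := dqk Q _ (D - 2) (perp_idx nu j) x.-1.
(* The four terms of a pair of nodes are sorted into symmetric, perpendicular and mixed parts; the
   mixed part carries the factor that [cross_ratio] makes zero. *)
transitivity (al * al' * (A * A' * (c * sym_ratio E Z (Q ^+ x)))
  + be * be' * (B * B' * (c * perp_ratio E Z (Q ^+ x)))
  + c * (wp * pp + wn * pn + (pp + pn)) * (al * A * be' * B' + al' * A' * be * B)).
  rewrite /sym_ratio /perp_ratio -/wp -/wn -/pp -/pn.
  by rewrite /=; ring.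
rewrite Hc Hw; ring.
Qed.

(** Only [mu = true] with i = D - 1 occurs, where (q^(2-D);q)_(D-1) contains a zero factor. This
    settles the degree D - 1, beyond the reach of orthogonality for diameter D - 2. *)
Lemma perp_coef_eq0 mu i : (i < D)%N -> (D - 2 < perp_idx mu i)%N ->
  perp_coef mu i = 0.
Proof.
case: mu => lt_iD /= lt_D; last by lia.
by rewrite /perp_coef qpoch_eq0 // mul0r oppr0.
Qed.

Lemma formL_ell_delta mu nu i j : (i < D)%N -> (j < D)%N ->
  formL q D k (ell q D k mu i) (ell q D k nu j) =
  sym_coef mu i * sym_coef nu j
    * ((sym_idx mu i == sym_idx nu j)%:R / dqk_dualwt Q s D (sym_idx nu j))
  + perp_const * (perp_coef mu i * perp_coef nu j)
    * ((perp_idx mu i == perp_idx nu j)%:R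
       / dqk_dualwt Q (s * Q ^+ 2) (D - 2) (perp_idx nu j)).
Proof.
move=> lt_iD lt_jD; rewrite formL_ell //; congr (_ * _ + _).
  by rewrite dqk_orthogonal //; [case: mu | case: nu]; rewrite // ltnW.
have [le_i|/perp_coef_eq0->//] := leqP (perp_idx mu i) (D - 2); last first.
  by rewrite mul0r mulr0 !mul0r.
have [le_j|/perp_coef_eq0->//] := leqP (perp_idx nu j) (D - 2); last first.
  by rewrite !mulr0 !mul0r.
by rewrite dqk_orthogonal.
Qed.

(** * Norms and the cancellation between neighbouring functions *)

Let sX0 n : s ^+ n != 0. Proof. exact: expf_neq0. Qed.

(** The symbol for D - 1 lies between those for D in [sym_coef] and for D - 2 in [perp_coef]; both
    are reduced to it. *)
Let A n := qpoch Q (Q ^- D.-1) n.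

Lemma qpoch_dec n : qpoch Q (Q ^- D) n.+1 = (1 - Z^-1) * A n.
Proof.
by rewrite qpochSl -[in Q ^- D * Q](prednK D_gt0) invqSK.
Qed.

Lemma qpoch_dec2 n :
  (1 - Q / Z) * qpoch Q (Q ^- (D - 2)) n = A n * (1 - Q ^+ n.+1 / Z).
Proof.
have -> : A n * (1 - Q ^+ n.+1 / Z) = A n.+1.
  by rewrite /A qpochS QD1 exprS; congr (_ * (1 - _)); field; rewrite Q0 QX0.
have e : Q ^- D.-1 * Q = Q ^- (D - 2).
  by rewrite (_ : D.-1 = (D - 2).+1) ?invqSK //; lia.
by rewrite /A qpochSl e QD1 invf_div.
Qed.

Lemma Nval_qpoch mu i : (i < D)%N ->
  Nval q D k mu i = E ^+ mu * (A i / (s ^+ i * qpoch Q Q i)).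
Proof.
move=> lt_iD; rewrite /Nval.
have -> : Qp q k 0 (if mu then i%:Z + 1 else i) = E ^+ mu * E ^+ i.
  rewrite QpE // expr0z mul1r; case: mu; rewrite ?expr0 ?mul1r //.
  by rewrite -PoszD addn1 -exprnP exprS expr1.
rewrite -mulrA; congr (_ * _).
have -> : \prod_(1 <= n < i.+1) ((Z - Q ^+ n) / (Q ^+ n - 1))
   = (- Z) ^+ i * (A i / qpoch Q Q i).
  elim: i {lt_iD} => [|i IH]; first by rewrite big_nil expr0 /A !qpoch0 divr1 mulr1.
  rewrite big_nat_recr //= IH /A !qpochS QD1 !exprS.
  have := Qn1 i; have := Qpoch0 i; have := QX0 D; rewrite exprS.
  have := Q0.
  move: (qpoch _ _ _) (qpoch _ _ _) => b a.
  move: (Q) (Z) (Q ^+ i) ((- Z) ^+ i) => v z u n v0 z0 b0 h.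
  have h' : v * u - 1 != 0 by rewrite -opprB oppr_eq0.
  by field; rewrite v0 z0 b0 h h'.
have -> : E ^+ i * ((- Z) ^+ i * (A i / qpoch Q Q i))
  = (s ^+ i)^-1 * (A i / qpoch Q Q i).
  rewrite mulrA -exprMn -exprVn; congr (_ ^+ _ * _).
  by rewrite invrN invrK mulrN mulrC.
by have := sX0 i; move: (s ^+ i) => S S0; field; rewrite S0 Qpoch0.
Qed.

Let dualwt_perp n : dqk_dualwt Q (s * Q ^+ 2) (D - 2) n
  = qpoch Q (Q ^- (D - 2)) n / (qpoch Q Q n * s ^+ n * (Q ^+ n) ^+ 2).
Proof.
rewrite /dqk_dualwt exprVn exprMn -[(Q ^+ 2) ^+ n]exprM mulnC exprM.
have := sX0 n; move: (s ^+ n) => S S0.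
by field; rewrite S0 QX0 Qpoch0.
Qed.

Let dualwt_sym n : dqk_dualwt Q s D n = qpoch Q (Q ^- D) n / (qpoch Q Q n * s ^+ n).
Proof.
rewrite /dqk_dualwt exprVn.
have := sX0 n; move: (s ^+ n) => S S0.
by field; rewrite S0 Qpoch0.
Qed.

Let ZQ_neq0 : Z - Q != 0.
Proof. by rewrite -[X in _ - X]expr1 subqX_neq0 // gtn_eqF // ltnW. Qed.

Let A_neq0 n : (n < D)%N -> A n != 0.
Proof. by move=> lt_nD; rewrite /A qpochqN_neq0 // -ltnS prednK. Qed.

Let qpoch_dec2E n : qpoch Q (Q ^- (D - 2)) n = A n * (Z - Q ^+ n.+1) / (Z - Q).
Proof.
have h : 1 - Q / Z != 0.
  have -> : 1 - Q / Z = (Z - Q) / Z by field; exact: QX0.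
  by rewrite mulf_neq0 ?invr_eq0.
apply: (mulfI h); rewrite qpoch_dec2; field; by rewrite ZQ_neq0 QX0.
Qed.

Lemma ellp_norm i : (i < D)%N ->
  sym_coef true i * sym_coef true i / dqk_dualwt Q s D i.+1
  + perp_const * (perp_coef true i * perp_coef true i)
    / dqk_dualwt Q (s * Q ^+ 2) (D - 2) i
  = E * (A i / (s ^+ i * qpoch Q Q i)).
Proof.
move=> lt_iD; rewrite /sym_coef /perp_coef dualwt_perp dualwt_sym qpoch_dec qpoch_dec2E.
rewrite /perp_const.
rewrite !qpochS -!exprS ![s ^+ i.+1]exprS.
have := sX0 i; move: (s ^+ i) => S S0.
have := A_neq0 _ lt_iD; have := Qn1 i; have := Qpoch0 i.
have := QX0 i; have := QX0 D; have := ZQ_neq0; have := Z10.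
(* The equality means i = D - 1: the perpendicular coefficient and the dual weight dividing it are
   both zero, the quotient is 0 by convention, and the symmetric part alone gives the norm. *)
have [eZ|ZW] := eqVneq (Q ^+ i.+1) Z.
  rewrite eZ subrr !mulr0 !mul0r oppr0 !mulr0 !mul0r addr0; have := Q0; have := E0.
  move: (A i) (qpoch _ _ _) => a p; move: (Q) (E) (Z) (Q ^+ i) => u e z w.
  move=> e0 u0 h1 h2 z0 w0 p0 h3 a0.
  by field; rewrite p0 S0 e0 z0 h3 a0 h1.
have ZW' : Z - Q ^+ i.+1 != 0 by rewrite subr_eq0 eq_sym.
move: ZW'; have := Q0; have := E0.
move: (A i) (qpoch _ _ _) => a p; move: (Q) (E) (Z) (Q ^+ i) (Q ^+ i.+1) => u e z w w'.
move=> e0 u0 h4 h1 h2 z0 w0 p0 h3 a0.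
have h5 : 1 - z != 0 by rewrite -opprB oppr_eq0.
by field; rewrite p0 S0 w0 h2 h4 a0 h5 u0 e0 z0 h3 h1.
Qed.

Let subZQX_neq0 i : (i < D)%N -> Z - Q ^+ i != 0.
Proof. by move=> lt_iD; rewrite subqX_neq0 // gtn_eqF. Qed.

Lemma ellm_norm i : (i < D)%N ->
  sym_coef false i * sym_coef false i / dqk_dualwt Q s D i
  + perp_const * (perp_coef false i * perp_coef false i)
    / dqk_dualwt Q (s * Q ^+ 2) (D - 2) i.-1
  = A i / (s ^+ i * qpoch Q Q i).
Proof.
case: i => [_|i lt_iD]; rewrite /sym_coef /perp_coef dualwt_perp dualwt_sym.
  rewrite /A !qpoch0 !expr0 subrr !mul0r oppr0 !mulr0 !mul0r addr0.
  by field; exact: Z10.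
have -> : A i.+1 = A i * (Z - Q ^+ i.+1) / Z.
  by rewrite /A qpochS QD1 exprS; field; rewrite Q0 QX0.
rewrite [_.+1.-1]/= qpoch_dec qpoch_dec2E /perp_const.
rewrite !qpochS -!exprS ![s ^+ i.+1]exprS.
have := sX0 i; move: (s ^+ i) => S S0.
have := A_neq0 _ (ltnW lt_iD); have := Qn1 i; have := Qpoch0 i.
have := QX0 i; have := QX0 D; have := ZQ_neq0; have := Z10.
have := subZQX_neq0 _ lt_iD; have := Q0; have := E0.
move: (A i) (qpoch _ _ _) => a p; move: (Q) (E) (Z) (Q ^+ i) (Q ^+ i.+1) => u e z w w'.
move=> e0 u0 h4 h1 h2 z0 w0 p0 h3 a0.
by field; rewrite e0 z0 h3 p0 S0 w0 h2 h4 a0 h1 u0.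
Qed.

(** The functions ell^+_i and ell^-_(i+1) share both degrees, i + 1 in the symmetric part and i in
    the perpendicular one. Among distinct functions only such pairs have nonzero contributions, and
    these are opposite. *)
Lemma ellp_ellm_cancel i : (i.+1 < D)%N ->
  sym_coef true i * sym_coef false i.+1 / dqk_dualwt Q s D i.+1
  + perp_const * (perp_coef true i * perp_coef false i.+1)
    / dqk_dualwt Q (s * Q ^+ 2) (D - 2) i
  = 0.
Proof.
move=> lt_iD; rewrite /sym_coef /perp_coef dualwt_perp dualwt_sym.
rewrite [_.+1.-1]/= qpoch_dec qpoch_dec2E /perp_const.
rewrite !qpochS -!exprS ![s ^+ i.+1]exprS.
have := sX0 i; move: (s ^+ i) => S S0.
have := A_neq0 _ (ltnW lt_iD); have := Qn1 i; have := Qpoch0 i.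
have := QX0 i; have := QX0 D; have := ZQ_neq0; have := Z10.
have := subZQX_neq0 _ lt_iD; have := Q0; have := E0.
move: (A i) (qpoch _ _ _) => a p; move: (Q) (E) (Z) (Q ^+ i) (Q ^+ i.+1) => u e z w w'.
move=> e0 u0 h4 h1 h2 z0 w0 p0 h3 a0.
have h5 : 1 - z != 0 by rewrite -opprB oppr_eq0.
by field; rewrite w0 S0 p0 h2 h4 a0 h3 h1 h5 u0 e0 z0.
Qed.

Lemma formL_ell_orthogonal mu nu i j : (i < D)%N -> (j < D)%N ->
  formL q D k (ell q D k mu i) (ell q D k nu j)
  = if (i == j) && (mu == nu) then Nval q D k mu i else 0.
Proof.
move=> lt_iD lt_jD; rewrite formL_ell_delta //.
(* The truncated index [0.-1] makes ell^-_0 agree in perpendicular degree with ell^-_1 and ell^+_0;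
   the spurious Kronecker deltas are killed by this coefficient. *)
have perp00 : perp_coef false 0 = 0.
  by rewrite /perp_coef expr0 subrr !mul0r oppr0.
have zero (c c' v v' : algC) : c * (0%:R / v) + c' * (0%:R / v') = 0.
  by rewrite !mul0r !mulr0 addr0.
case: mu; case: nu; rewrite /sym_idx /perp_idx ?andbT ?andbF ?eqSS.
- case: eqVneq => [<-|_]; last exact: zero.
  by rewrite !div1r ellp_norm // Nval_qpoch // expr1.
- case: j lt_jD => [|j] lt_jD.
    by rewrite perp00 !mulr0 !mul0r addr0 mulr0.
  rewrite eqSS; case: eqVneq => [eij|_]; last exact: zero.
  by rewrite eij !div1r ellp_ellm_cancel // -eij.
- case: i lt_iD => [|i] lt_iD.
    by rewrite perp00 !(mul0r, mulr0) addr0.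
  rewrite eqSS eq_sym; case: eqVneq => [eij|_]; last exact: zero.
  rewrite eij !div1r -[RHS](ellp_ellm_cancel i) //.
  by rewrite [sym_coef true _ * _]mulrC [perp_coef true _ * _]mulrC.
- case: (eqVneq i j) => [<-|ne].
    by rewrite !eqxx !div1r ellm_norm // Nval_qpoch // expr0 mul1r.
  case: i j lt_iD lt_jD ne => [|i] [|j] lt_iD lt_jD ne //.
  + by rewrite perp00 !(mul0r, mulr0) addr0.
  + by rewrite perp00 !(mul0r, mulr0) addr0.
  + have -> : (i.+1.-1 == j.+1.-1) = false by exact: negbTE.
    exact: zero.
Qed.

End DualPolar.

Theorem theorem10p7 (q D k : nat)
  (hq : exists p m : nat, [/\ prime p, (0 < m)%N & q = p ^ m]%N)
  (hD : (3 <= D)%N) (hk : (k <= 4)%N)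
  (hsq : odd k -> exists r : nat, q = (r ^ 2)%N)
  (i j : nat) (mu nu : bool) (hi : (i < D)%N) (hj : (j < D)%N) :
  formL q D k (ell q D k mu i) (ell q D k nu j)
  = (if (i == j) && (mu == nu) then Nval q D k mu i else 0).
Proof.
apply: formL_ell_orthogonal => //.
have [p [m [p_prime m_gt0 ->]]] := hq.
by rewrite (leq_trans (prime_gt1 p_prime)) // -{1}[p]expn1 leq_exp2l // prime_gt1.
Qed.
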